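(* Let $p$ be a prime and let $f\in\mathbb{Z}_p[x_0,x_1,x_2,x_3]$ be a random homogeneous polynomial of degree $3$ sampled from the uniform distribution. Then the expected number of $p$-adic lines on the cubic surface $Z(f)\subset\mathbb{Q}_p\mathrm{P}^3$ is $$\frac{(p^3-1)(p^2+1)}{p^5-1}.$$
   Context: $\mathbb{Z}_p$ carries the Haar probability measure; a $\mathbb{Z}_p$-valued random variable is uniform if its law is this measure. The uniform distribution on homogeneous polynomials of degree $3$ in $x_0,\dots,x_3$ with coefficients in $\mathbb{Z}_p$ is the law of $f=\sum_{|\alpha|=3}\xi_\alpha x_0^{\alpha_0}\cdots x_3^{\alpha_3}$ with $\{\xi_\alpha\}_{|\alpha|=3}$ i.i.d. uniform in $\mathbb{Z}_p$. $Z(f)$ is the zero set of $f$ in the projective space over $\mathbb{Q}_p$. A $p$-adic line is $P(L)\subset\mathbb{Q}_p\mathrm{P}^3$ with $L\subset\mathbb{Q}_p^4$ a $2$-dimensional linear subspace; it lies on $Z(f)$ if $f|_L=0$. *)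

(* Defs.v *)
From HB Require Import structures.
From mathcomp Require Import all_boot all_order all_algebra.
From mathcomp Require Import all_classical all_reals all_analysis.
(* The notations of mpoly clash with those of mathcomp-analysis. *)
From mathcomp.multinomials Require Import (canonicals, coercions) mpoly.

Set Implicit Arguments.
Unset Strict Implicit.
Unset Printing Implicit Defensive.

Import Order.TTheory GRing.Theory Num.Theory.

Local Open Scope classical_set_scope.
Local Open Scope ring_scope.

(* Z_p is the inverse limit of the rings Z/p^k, k >= 1: the component of index
   n is the residue modulo p ^ n.+1.  The shift keeps the modulus above 1, as
   required by 'Z_m.  The primality proof is a parameter of the type because
   the integral domain structure depends on it. *)
Record padic_int (p : nat) (p_pr : prime p) := PadicInt {
  residue : forall n, 'Z_(p ^ n.+1);
  residue_compat : forall n,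
    (residue n.+1 : nat) = residue n %[mod p ^ n.+1] }.

Section PadicIntRing.
Variables (p : nat) (p_pr : prime p).
Local Notation Zp := (padic_int p_pr).
Implicit Types x y z : Zp.

HB.instance Definition _ := gen_eqMixin Zp.
HB.instance Definition _ := gen_choiceMixin Zp.

Lemma expn_gt1S n : (1 < p ^ n.+1)%N.
Proof. by rewrite -(exp1n n.+1) ltn_exp2r // prime_gt1. Qed.

Lemma Zp_cast_expn n : (Zp_trunc (p ^ n.+1)).+2 = (p ^ n.+1)%N.
Proof. exact: Zp_cast (expn_gt1S n). Qed.

Lemma val_ZpD n (u v : 'Z_(p ^ n.+1)) :
  (u + v)%R = ((u + v) %% p ^ n.+1)%N :> nat.
Proof. by congr (_ %% _)%N; exact: Zp_cast_expn. Qed.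

Lemma val_ZpM n (u v : 'Z_(p ^ n.+1)) :
  (u * v)%R = ((u * v) %% p ^ n.+1)%N :> nat.
Proof. by congr (_ %% _)%N; exact: Zp_cast_expn. Qed.

Lemma val_ZpN n (u : 'Z_(p ^ n.+1)) :
  (- u)%R = ((p ^ n.+1 - u) %% p ^ n.+1)%N :> nat.
Proof. by congr ((_ - _) %% _)%N; exact: Zp_cast_expn. Qed.

Lemma ltn_Zp n (u : 'Z_(p ^ n.+1)) : (u < p ^ n.+1)%N.
Proof. by rewrite -[ltnRHS]Zp_cast_expn. Qed.

Lemma dvdn_expSS n : (p ^ n.+1 %| p ^ n.+2)%N.
Proof. by rewrite dvdn_exp2l. Qed.

Lemma padic_ext x y : (forall n, residue x n = residue y n) -> x = y.
Proof.
case: x y => [x xP] [y yP] /= xy.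
have {}xy : x = y by apply: functional_extensionality_dep.
by case: y / xy yP => yP; congr PadicInt; exact: Prop_irrelevance.
Qed.

Lemma const_compat (k : nat) n :
  ((k%:R%R : 'Z_(p ^ n.+2)) : nat) = (k%:R%R : 'Z_(p ^ n.+1)) %[mod p ^ n.+1].
Proof.
by rewrite !val_Zp_nat ?expn_gt1S// modn_mod modn_dvdm ?dvdn_expSS.
Qed.

Definition padic_nat (k : nat) : Zp :=
  @PadicInt p p_pr (fun n => k%:R) (const_compat k).

Lemma add_compat x y n :
  (((residue x n.+1 + residue y n.+1)%R : 'Z_(p ^ n.+2)) : nat)
    = ((residue x n + residue y n)%R : 'Z_(p ^ n.+1)) %[mod p ^ n.+1].
Proof.
rewrite !val_ZpD modn_mod modn_dvdm ?dvdn_expSS//.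
by rewrite -modnDm !residue_compat modnDm.
Qed.

Definition padic_add x y : Zp := PadicInt p_pr (add_compat x y).

Lemma mul_compat x y n :
  (((residue x n.+1 * residue y n.+1)%R : 'Z_(p ^ n.+2)) : nat)
    = ((residue x n * residue y n)%R : 'Z_(p ^ n.+1)) %[mod p ^ n.+1].
Proof.
rewrite !val_ZpM modn_mod modn_dvdm ?dvdn_expSS//.
by rewrite -modnMm !residue_compat modnMm.
Qed.

Definition padic_mul x y : Zp := PadicInt p_pr (mul_compat x y).

Lemma opp_compat x n :
  (((- residue x n.+1)%R : 'Z_(p ^ n.+2)) : nat)
    = ((- residue x n)%R : 'Z_(p ^ n.+1)) %[mod p ^ n.+1].
Proof.
rewrite !val_ZpN modn_mod modn_dvdm ?dvdn_expSS//.
apply/eqP; rewrite -(eqn_modDr (residue x n)) subnK ?(ltnW (ltn_Zp _))//.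
rewrite -modnDmr -(residue_compat x n) modnDmr subnK ?(ltnW (ltn_Zp _))//.
by rewrite modnn; exact: dvdn_expSS.
Qed.

Definition padic_opp x : Zp := PadicInt p_pr (opp_compat x).

Lemma padic_addA : associative padic_add.
Proof. by move=> x y z; apply: padic_ext => n; apply: addrA. Qed.
Lemma padic_addC : commutative padic_add.
Proof. by move=> x y; apply: padic_ext => n; apply: addrC. Qed.
Lemma padic_add0 : left_id (padic_nat 0) padic_add.
Proof. by move=> x; apply: padic_ext => n; apply: add0r. Qed.
Lemma padic_addN : left_inverse (padic_nat 0) padic_opp padic_add.
Proof. by move=> x; apply: padic_ext => n; apply: addNr. Qed.

HB.instance Definition _ :=
  GRing.isZmodule.Build Zp padic_addA padic_addC padic_add0 padic_addN.

Lemma padic_mulA : associative padic_mul.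
Proof. by move=> x y z; apply: padic_ext => n; apply: mulrA. Qed.
Lemma padic_mulC : commutative padic_mul.
Proof. by move=> x y; apply: padic_ext => n; apply: mulrC. Qed.
Lemma padic_mul1 : left_id (padic_nat 1) padic_mul.
Proof. by move=> x; apply: padic_ext => n; apply: mul1r. Qed.
Lemma padic_mulD : left_distributive padic_mul padic_add.
Proof. by move=> x y z; apply: padic_ext => n; apply: mulrDl. Qed.
Lemma padic_oner_neq0 : padic_nat 1 != 0.
Proof.
by apply/eqP => /(congr1 (fun x => residue x 0)) /= /eqP; rewrite oner_eq0.
Qed.

HB.instance Definition _ := GRing.Zmodule_isComNzRing.Build Zp
  padic_mulA padic_mulC padic_mul1 padic_mulD padic_oner_neq0.

Definition padic_unit : {pred Zp} := fun x => `[< exists y, y * x = 1 >].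

Definition padic_inv x : Zp :=
  if pselect (exists y, y * x = 1) is left xU then sval (cid xU) else x.

Lemma padic_mulVx : {in padic_unit, left_inverse 1 padic_inv *%R}.
Proof.
move=> x /asboolP xU; rewrite /padic_inv.
by case: pselect => // xU'; exact: svalP (cid xU').
Qed.

Lemma padic_unitPl x y : y * x = 1 -> x \in padic_unit.
Proof. by move=> yx; apply/asboolP; exists y. Qed.

Lemma padic_inv_out : {in [predC padic_unit], padic_inv =1 id}.
Proof.
move=> x; rewrite inE /= => /asboolPn xU.
by rewrite /padic_inv; case: pselect.
Qed.

HB.instance Definition _ := GRing.ComNzRing_hasMulInverse.Build Zp
  padic_mulVx padic_unitPl padic_inv_out.

Lemma residue_modn x n k :
  (residue x (n + k) : nat) = residue x n %[mod p ^ n.+1].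
Proof.
elim: k => [|k IHk]; first by rewrite addn0.
rewrite -IHk addnS -(@modn_dvdm (p ^ (n + k).+1)); last first.
  by rewrite dvdn_exp2l// ltnS leq_addr.
by rewrite residue_compat modn_dvdm// dvdn_exp2l// ltnS leq_addr.
Qed.

Lemma padic_neq0 x : x != 0 -> exists n, residue x n != 0.
Proof.
move=> x0; apply: contrapT => /forallNP x_eq0; case/eqP: x0.
by apply: padic_ext => n; apply/eqP/negPn/negP; exact: x_eq0.
Qed.

Lemma residue_ndvd x n k : residue x n != 0 ->
  ~~ (p ^ n.+1 %| residue x (n + k))%N.
Proof.
apply: contra => /eqP; rewrite residue_modn modn_small => [/eqP xn0|].
  by apply/eqP/val_inj/eqP.
by rewrite -[ltnRHS]Zp_cast_expn.
Qed.

Lemma ndvdn_mul (a b i j : nat) : ~~ (p ^ i.+1 %| a)%N ->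
  ~~ (p ^ j.+1 %| b)%N -> ~~ (p ^ (i + j).+1 %| a * b)%N.
Proof.
move=> na nb; have a0 : (0 < a)%N by case: a na => //; rewrite dvdn0.
have b0 : (0 < b)%N by case: b nb => //; rewrite dvdn0.
move: na nb; rewrite !pfactor_dvdn ?muln_gt0 ?a0// lognM// -!leqNgt.
exact: leq_add.
Qed.

Lemma padic_integral : GRing.integral_domain_axiom Zp.
Proof.
move=> x y xy0; apply/negPn/negP; rewrite negb_or => /andP[].
move=> /padic_neq0[i xi] /padic_neq0[j yj].
have := ndvdn_mul (residue_ndvd j xi) (residue_ndvd i yj).
rewrite (addnC j i) => /negP; apply.
have := congr1 (fun z => (residue z (i + j) : nat)) xy0.
by rewrite val_ZpM => /eqP.
Qed.

HB.instance Definition _ := GRing.ComUnitRing_isIntegral.Build Zp padic_integral.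

HB.instance Definition _ := isPointed.Build Zp 0.

End PadicIntRing.

Notation padic p_pr := {fraction (padic_int p_pr)}.

Section PadicIntBorel.
Variables (p : nat) (p_pr : prime p).
Local Notation Zp := (padic_int p_pr).

(* The closed ball of centre a and radius p ^- n.+1. *)
Definition padic_ball (a : Zp) (n : nat) : set Zp :=
  [set x | residue x n = residue a n].

Definition padic_open (U : set Zp) : Prop :=
  forall a, U a -> exists n, padic_ball a n `<=` U.

Lemma padic_ballS (a : Zp) m n : (m <= n)%N ->
  padic_ball a n `<=` padic_ball a m.
Proof.
move=> mn x; rewrite /padic_ball /= => xa; apply/val_inj.
rewrite /= -(modn_small (ltn_Zp p_pr (residue x m))).
rewrite -(modn_small (ltn_Zp p_pr (residue a m))).
by rewrite -(residue_modn x m (n - m)) -(residue_modn a m (n - m)) subnKC// xa.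
Qed.

Lemma padic_openT : padic_open setT.
Proof. by move=> a _; exists 0%N. Qed.

Lemma padic_openI (A B : set Zp) :
  padic_open A -> padic_open B -> padic_open (A `&` B).
Proof.
move=> oA oB a [/oA[m mA] /oB[n nB]]; exists (maxn m n) => x xa; split.
  by apply/mA/(padic_ballS (leq_maxl m n)).
by apply/nB/(padic_ballS (leq_maxr m n)).
Qed.

Lemma padic_open_bigU (I : Type) (A : I -> set Zp) :
  (forall i, padic_open (A i)) -> padic_open (\bigcup_i A i).
Proof.
by move=> oA a [i _ /(oA i)[n nA]]; exists n => x /nA Aix; exists i.
Qed.

HB.instance Definition _ := @isOpenTopological.Build Zp padic_open
  padic_openT padic_openI padic_open_bigU.

End PadicIntBorel.

Definition padic_borel (p : nat) (p_pr : prime p) :=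
  g_sigma_algebraType (@open (padic_int p_pr)).

(* Among the probability measures on the Borel sets of Z_p, the Haar measure is
   the only translation invariant one. *)
Definition is_haar (R : realType) (p : nat) (p_pr : prime p)
    (mu : probability (padic_borel p_pr) R) : Prop :=
  forall (a : padic_int p_pr) (A : set (padic_borel p_pr)),
    measurable A -> mu [set a + x | x in (A : set (padic_int p_pr))] = mu A.

Definition mutually_independent (R : realType) d (Omega : measurableType d)
    (P : probability Omega R) d' (T : measurableType d') (I : finType)
    (X : I -> {RV P >-> T}) : Prop :=
  forall (J : {set I}) (A : I -> set T), (forall i, measurable (A i)) ->
    P (\bigcap_(i in [set` J]) (X i @^-1` A i))
      = (\prod_(i in J) P (X i @^-1` A i))%E.

Definition cubic_monomial :=
  {m : mpoly.bmultinom 4 4 | mpoly.mdeg m == 3%N}.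

HB.instance Definition _ := Finite.on cubic_monomial.

Definition cubic_of (A : nzRingType) (c : cubic_monomial -> A) :
    mpoly.mpoly 4 A :=
  \sum_(m : cubic_monomial) c m *: mpoly.mpolyX A (mpoly.bmnm (val m)).

(* L stands for the projective line P(L). *)
Definition padic_lines_on (p : nat) (p_pr : prime p)
    (f : mpoly.mpoly 4 (padic_int p_pr)) : set {vspace 'rV[padic p_pr]_4} :=
  [set L | \dim L = 2%N /\
    forall v : 'rV[padic p_pr]_4, v \in L ->
      mpoly.meval (fun i => v 0 i)
        (mpoly.map_mpoly (@tofrac (padic_int p_pr)) f) = 0].

(* Main.v *)
(* A line of P^3 over Q_p has a unique basis of integral vectors in row reduced
   echelon form modulo p.  Hence the lines are parametrised by six copies of
   Z_p^4, one for each pair of pivots, some coordinates being restricted to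
   p Z_p, and the lines on the cubic f correspond to the solutions of four
   equations in four unknowns, which say that f vanishes on the line.
   The Jacobian matrix of this system is the Sylvester matrix of the two binary
   quadratic forms by which the partial derivatives of f in the two directions
   transverse to the line restrict to it.

   By Newton's method, if 2 k <= n, then p^k times the number of zeros whose
   Jacobian determinant has valuation k is the number of such zeros modulo
   p^(n+1).  For each fixed A, the restriction of f to the line and the two
   binary quadratic forms are jointly uniform.  Hence the expected number of
   these zeros is p^(-m) p^(-k) P(v(Res) = k) in a chart with m restricted
   coordinates, where Res is the resultant of two uniform binary quadratic forms
   over Z_p.  The law of v(Res) satisfies a linear recursion, obtained by
   dividing out p from forms that are dependent modulo p, and
   E[p^(-v(Res))] = (1 - r) / (1 - r^5) with r = 1/p.  Summing over k and over
   the six charts gives (1 + r + 2 r^2 + r^3 + r^4) (1 - r) / (1 - r^5); almost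
   surely no zero has Jacobian determinant 0. *)

From HB Require Import structures.
Require Import Defs.
From mathcomp Require Import all_boot all_order all_algebra.
From mathcomp Require Import all_classical all_reals all_analysis.
From mathcomp Require Import measurable_realfun.
From mathcomp Require Import ring lra zify finmap.
From mathcomp.multinomials Require Import (canonicals, coercions) mpoly.

Set Implicit Arguments.
Unset Strict Implicit.
Unset Printing Implicit Defensive.

Import Order.TTheory GRing.Theory Num.Theory.
Import numFieldNormedType.Exports.

Local Open Scope classical_set_scope.
Local Open Scope ring_scope.

(** * Counting over the rings Z/p^n *)

(** The probabilities are reduced to counts over finite rings. Modulo p^(n+1), the cubic is affine
    along displacements divisible by p^(n-k+1) around a zero of valuation k. So the approximate
    zeros fall into cosets of the kernel of the Jacobian matrix, which has order p^k; this is the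
    origin of the factor p^k. It follows that the number of zeros of valuation k depends only on the
    coefficients modulo p^(2k+1), which makes it measurable. Its mean is elementary: a chart has
    p^(4(n+1)-m) classes of A, and each of them is a zero with probability p^(-4(n+1)),
    independently of the resultant. The number of lines is not shown to be measurable. It agrees
    with a measurable series outside a null set, and its integral is squeezed between those of two
    measurable modifications. For the null set one takes the cubics with a singular zero modulo
    every p^(n+1), whose probability is controlled by a first moment bound. *)

HB.instance Definition _ (U V : finZmodType) := GRing.Zmodule.on (U * V)%type.

(** Every nonempty fibre of an additive map is a coset of its kernel. This allows sums over an
    image, such as the vectors divisible by p, to be taken over the source. *)
Lemma sum_additive (U V : finZmodType) (phi : U -> V) (g : V -> nat) :
  {morph phi : x y / x - y} ->
  (\sum_u g (phi u) = #|[pred u | phi u == 0%R]| * \sum_(v in codom phi) g v)%N.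
Proof.
move=> phiB; rewrite (partition_big phi [in codom phi]) /=; last first.
  by move=> u _; exact: codom_f.
rewrite big_distrr; apply: eq_bigr => _ /codomP[u0 ->].
rewrite (eq_bigr (fun=> g (phi u0))); last by move=> u /eqP ->.
rewrite sum_nat_const; congr (_ * _)%N.
rewrite -(card_imset [pred u | phi u == 0] (addrI u0)); apply: eq_card => u.
apply/eqP/imsetP => [phiu|[x]]; last first.
  rewrite inE => /eqP phix ->; apply/eqP.
  by rewrite -subr_eq0 -phiB (addrC u0) addrK phix.
by exists (u - u0); rewrite ?inE ?phiB ?phiu ?subrr// addrC subrK.
Qed.

(** [tau v] embeds the fibre over w into the fibre over w + v, so all fibres have the same
    cardinality and [phi] is equidistributed. *)
Lemma card_equivariant (U : finType) (V : finZmodType) (phi : U -> V)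
    (tau : V -> U -> U) (P : pred V) :
  (forall v, injective (tau v)) -> (forall v u, phi (tau v u) = phi u + v) ->
  (#|[pred u | P (phi u)]| * #|V| = #|P| * #|U|)%N.
Proof.
move=> tau_inj phi_tau.
have fib v : #|[pred u | phi u == v]| = #|[pred u | phi u == 0]|.
  have le v1 v2 : (#|[pred u | phi u == v1]| <= #|[pred u | phi u == v2]|)%N.
    rewrite -(card_imset [pred u | phi u == v1] (tau_inj (v2 - v1))).
    apply: subset_leq_card; apply/fintype.subsetP => _ /imsetP[u + ->].
    by rewrite !inE phi_tau => /eqP ->; rewrite addrC subrK.
  by apply/eqP; rewrite eqn_leq !le.
have count (Q : pred V) :
    #|[pred u | Q (phi u)]| = (#|Q| * #|[pred u | phi u == 0%R]|)%N.
  rewrite -sum1_card (partition_big phi Q) //= -sum_nat_const.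
  apply: eq_bigr => v Qv; rewrite sum1_card -(fib v); apply: eq_card => u.
  rewrite !inE; apply/andP/idP => [[]//|/eqP phiu]; split; rewrite ?phiu//.
  by rewrite inE phiu.
have cardU : #|U| = (#|V| * #|[pred u | phi u == 0%R]|)%N by exact: count predT.
by rewrite (count P) cardU mulnAC mulnA.
Qed.

Section ResidueRing.
Variables (p : nat) (p_pr : prime p) (n : nat).
Local Notation R := 'Z_(p ^ n.+1).

Definition pdvd (j : nat) (x : R) : bool := (p ^ j %| x)%N.

Lemma pdvdn_mod j m : (j <= n.+1)%N ->
  (p ^ j %| m %% p ^ n.+1)%N = (p ^ j %| m)%N.
Proof.
by move=> jn; rewrite /dvdn modn_dvdm// dvdn_exp2l.
Qed.

Lemma card_R : #|{: R}| = (p ^ n.+1)%N.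
Proof. by rewrite card_ord Zp_cast_expn. Qed.

Lemma pdvd0 j : pdvd j 0.
Proof. by rewrite /pdvd dvdn0. Qed.

Lemma pdvdT x : pdvd 0 x.
Proof. by rewrite /pdvd expn0 dvd1n. Qed.

Lemma pdvdW i j x : (i <= j)%N -> pdvd j x -> pdvd i x.
Proof. by move=> ij; apply: dvdn_trans; rewrite dvdn_exp2l. Qed.

Lemma pdvd_nat j m : (j <= n.+1)%N -> pdvd j m%:R = (p ^ j %| m)%N.
Proof.
by move=> jn; rewrite /pdvd val_Zp_nat ?pdvdn_mod// expn_gt1S.
Qed.

Lemma Zp_natP (x : R) : x = (x : nat)%:R.
Proof. by rewrite natr_Zp. Qed.

Lemma pdvdP j (x : R) : (j <= n.+1)%N ->
  reflect (exists y, x = p%:R ^+ j * y) (pdvd j x).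
Proof.
move=> jn; apply: (iffP idP) => [/dvdnP[k xk]|[y ->]].
  by exists k%:R; rewrite {1}(Zp_natP x) xk natrM natrX mulrC.
by rewrite (Zp_natP y) -natrX -natrM pdvd_nat// dvdn_mulr.
Qed.

Lemma pdvd1P (x : R) : reflect (exists y, x = p%:R * y) (pdvd 1 x).
Proof.
by apply: (iffP (@pdvdP 1 x isT)) => -[y ->]; exists y; rewrite expr1.
Qed.

Lemma pdvdD j x y : (j <= n.+1)%N -> pdvd j x -> pdvd j y -> pdvd j (x + y).
Proof.
move=> jn /(pdvdP _ jn)[x' ->] /(pdvdP _ jn)[y' ->].
by apply/(pdvdP _ jn); exists (x' + y'); rewrite mulrDr.
Qed.

Lemma pdvdMr j x y : (j <= n.+1)%N -> pdvd j x -> pdvd j (y * x).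
Proof.
move=> jn /(pdvdP _ jn)[x' ->].
by apply/(pdvdP _ jn); exists (y * x'); rewrite mulrCA.
Qed.

Lemma pdvdMl j x y : (j <= n.+1)%N -> pdvd j x -> pdvd j (x * y).
Proof. by move=> jn; rewrite mulrC; exact: pdvdMr. Qed.

Lemma pdvdN j x : (j <= n.+1)%N -> pdvd j (- x) = pdvd j x.
Proof.
move=> jn; have h y : pdvd j y -> pdvd j (- y).
  by rewrite -mulN1r; exact: pdvdMr.
by apply/idP/idP => /h//; rewrite opprK.
Qed.

Lemma pdvdB j x y : (j <= n.+1)%N -> pdvd j x -> pdvd j y -> pdvd j (x - y).
Proof. by move=> jn jx jy; apply: pdvdD; rewrite ?pdvdN. Qed.

Lemma pdvd_addl j x y : (j <= n.+1)%N -> pdvd j y -> pdvd j (x + y) = pdvd j x.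
Proof.
move=> jn jy; apply/idP/idP => [jxy|jx]; last exact: pdvdD.
by rewrite -(addrK y x); exact: pdvdB.
Qed.

Lemma pdvd_unit (x : R) : (x \is a GRing.unit) = ~~ pdvd 1 x.
Proof.
rewrite {1}(Zp_natP x) unitZpE ?expn_gt1S// coprime_pexpl//.
by rewrite prime_coprime.
Qed.

Lemma pdvd_unitM j u x : (j <= n.+1)%N -> u \is a GRing.unit ->
  pdvd j (u * x) = pdvd j x.
Proof.
move=> jn uU; apply/idP/idP; last exact: pdvdMr.
by move=> /(pdvdMr u^-1 jn); rewrite mulKr.
Qed.

Lemma pdvd1M x y : pdvd 1 (x * y) = pdvd 1 x || pdvd 1 y.
Proof.
apply/idP/orP => [|[]]; last 2 first.
- exact: pdvdMl.
- exact: pdvdMr.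
case/boolP : (pdvd 1 x) => [|/=]; first by left.
by rewrite -pdvd_unit => xU; rewrite pdvd_unitM//; right.
Qed.

(** For j < i the truncated subtraction yields the trivial condition. This is the source of [j - 2]
    in the recursions for the resultant. *)
Lemma pdvd_pM j i x : (j <= n.+1)%N -> pdvd j (p%:R ^+ i * x) = pdvd (j - i) x.
Proof.
move=> jn; rewrite {1}(Zp_natP x) -natrX -natrM pdvd_nat// /pdvd.
case: (leqP j i) => [ji|/ltnW ij].
  have -> : (j - i = 0)%N by apply/eqP; rewrite subn_eq0.
  by rewrite expn0 dvd1n dvdn_mulr// dvdn_exp2l.
by rewrite -{1}(subnKC ij) expnD dvdn_pmul2l// expn_gt0 prime_gt0.
Qed.

Lemma pX_eq0 : p%:R ^+ n.+1 = 0 :> R.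
Proof.
rewrite -natrX; apply: val_inj.
by rewrite /= val_Zp_nat ?expn_gt1S// modnn.
Qed.

Lemma pX_mul_eq0 i (x : R) : (i <= n.+1)%N ->
  (p%:R ^+ i * x == 0) = pdvd (n.+1 - i) x.
Proof.
move=> ni; apply/eqP/idP => [x0|].
  by rewrite -pdvd_pM// x0 pdvd0.
move/(pdvdP _ (leq_subr _ _)) => [y ->].
by rewrite mulrA -exprD subnKC// pX_eq0 mul0r.
Qed.

Lemma card_pdvd j : (j <= n.+1)%N ->
  (#|[pred x : R | pdvd j x]| * p ^ j = p ^ n.+1)%N.
Proof.
move=> jn; have pj0 : (0 < p ^ j)%N by rewrite expn_gt0 prime_gt0.
have lt_pj (i : 'I_(p ^ (n.+1 - j))) : (p ^ j * i < p ^ n.+1)%N.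
  by rewrite -{2}(subnK jn) expnD mulnC ltn_pmul2r.
pose f (i : 'I_(p ^ (n.+1 - j))) : R := (p ^ j * i)%N%:R.
have valf i : f i = (p ^ j * i)%N :> nat.
  by rewrite val_Zp_nat ?expn_gt1S// modn_small.
have finj : injective f.
  move=> i i' /(congr1 (@nat_of_ord _)); rewrite !valf => /eqP.
  by rewrite eqn_pmul2l// => /eqP/val_inj.
transitivity (#|'I_(p ^ (n.+1 - j))| * p ^ j)%N; last first.
  by rewrite card_ord -expnD subnK.
congr (_ * _)%N.
rewrite -(card_imset _ finj); apply: eq_card => x.
apply/idP/imsetP => [/dvdnP[k xk]|[i _ ->]]; last by rewrite inE /pdvd valf dvdn_mulr.
have ki : (k < p ^ (n.+1 - j))%N.
  by rewrite -(ltn_pmul2r pj0) -expnD subnK// -xk ltn_Zp.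
exists (Ordinal ki) => //; apply: val_inj.
by rewrite [RHS]valf /= [LHS]xk mulnC.
Qed.

End ResidueRing.

(** * The resultant of two binary quadratic forms *)

(* The resultant of the binary quadratic forms with coefficients x and y; see
   det_sylv. *)
Definition bres (A : comPzRingType) (x y : A * A * A) : A :=
  (x.1.1 * y.2 - y.1.1 * x.2) ^+ 2
  - (x.1.1 * y.1.2 - y.1.1 * x.1.2) * (x.1.2 * y.2 - y.1.2 * x.2).

Section ResultantCount.
Variables (p : nat) (p_pr : prime p) (n : nat).
Local Notation R := 'Z_(p ^ n.+1).
Local Notation q := (p ^ n.+1)%N.
Local Notation V := (R * R * R)%type.
Implicit Types x y v : V.

Definition primitive (x : V) := ~~ [&& pdvd 1 x.1.1, pdvd 1 x.1.2 & pdvd 1 x.2].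

(** Linear independence modulo p: one of the three 2 x 2 minors has to be a unit. *)
Definition independent (x y : V) :=
  primitive (x.1.1 * y.1.2 - y.1.1 * x.1.2, x.1.1 * y.2 - y.1.1 * x.2,
             x.1.2 * y.2 - y.1.2 * x.2).

Lemma card_units : #|[pred x : R | x \is a GRing.unit]| = (p ^ n * p.-1)%N.
Proof.
have aux (k l : nat) : (k * p ^ 1 = q -> k + l = q -> l = p ^ n * p.-1)%N.
  rewrite expn1 expnSr => /eqP; rewrite eqn_pmul2r ?prime_gt0// => /eqP ->.
  by rewrite -[X in _ = (_ * X)%N -> _](prednK (prime_gt0 p_pr)) mulnS => /addnI.
have := cardC [pred x : R | pdvd 1 x]; rewrite card_R//.
move=> /(aux _ _ (card_pdvd p_pr (n := n) (j := 1) isT)) <-.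
by apply: eq_card => x; rewrite !inE pdvd_unit.
Qed.

(** The annihilator of p in [R]. *)
Let K := [pred x : R | pdvd n x].

Let cardK : #|K| = p.
Proof.
have aux (k : nat) : (k * p ^ n = q -> k = p)%N.
  by move=> /eqP; rewrite expnS eqn_pmul2r ?expn_gt0 ?prime_gt0// => /eqP.
exact: aux (card_pdvd p_pr (leqnSn n)).
Qed.

Let V3 (P : pred R) : pred V := [predX [predX P & P] & P].

Let cardV3 P : #|V3 P| = (#|P| ^ 3)%N.
Proof.
have cube (k : nat) : (k * k * k = k ^ 3)%N by rewrite !expnS expn0 muln1 mulnA.
by rewrite !cardX cube.
Qed.

Let pmul x : V := (p%:R * x.1.1, p%:R * x.1.2, p%:R * x.2).

(** Multiplication by p maps onto the nonprimitive vectors, with a kernel of order p^3. Since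
    division by p is ambiguous modulo p^(n+1), the sum is transported along this map instead. *)
Lemma sum_nonprimitive (g : V -> nat) :
  (p ^ 3 * \sum_(x | ~~ primitive x) g x = \sum_x g (pmul x))%N.
Proof.
rewrite (sum_additive (phi := pmul)) => [|x y]; last by rewrite /pmul /= !mulrBr.
congr (_ * _)%N.
  rewrite -{1}cardK -cardV3; apply: eq_card => -[[a b] c].
  by rewrite !inE /= -!andbA !xpair_eqE -[p%:R]expr1 !pX_mul_eq0// subn1 andbA.
apply: eq_bigl => -[[a b] c]; rewrite /primitive negbK /=.
apply/and3P/codomP => [[]|[[[a' b'] c']] [-> -> ->]].
  move=> /(pdvd1P p_pr)[a' ->] /(pdvd1P p_pr)[b' ->].
  by move=> /(pdvd1P p_pr)[c' ->]; exists (a', b', c').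
by split; apply/(pdvd1P p_pr); eexists.
Qed.

Let cardD1 : #|[pred l : R | pdvd 1 l]| = (p ^ n)%N.
Proof.
have aux (k : nat) : (k * p ^ 1 = q -> k = p ^ n)%N.
  by rewrite expn1 expnSr => /eqP; rewrite eqn_pmul2r ?prime_gt0// => /eqP.
exact: aux (card_pdvd p_pr (n := n) (j := 1) isT).
Qed.

Let comb x (u : R * V) : V :=
  (u.1 * x.1.1 + p%:R * u.2.1.1, u.1 * x.1.2 + p%:R * u.2.1.2,
   u.1 * x.2 + p%:R * u.2.2).

(* The representative of l / p, for l divisible by p. *)
Let quo (l : R) : R := (l %/ p)%N%:R.

Let quoK l : pdvd 1 l -> p%:R * quo l = l.
Proof.
rewrite /pdvd expn1 => pl.
by rewrite -natrM mulnC divnK// natr_Zp.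
Qed.

(** For p | l, replacing v by v - (l / p) x turns l x + p v into p v. Hence [shift x] carries a
    product set onto the kernel of [comb x]. *)
Let shift x (u : R * V) : R * V :=
  (u.1, (u.2.1.1 - quo u.1 * x.1.1, u.2.1.2 - quo u.1 * x.1.2,
         u.2.2 - quo u.1 * x.2)).

(** As x is primitive, l x + p v = 0 forces p | l, which leaves p^n values of l; then l fixes each
    coordinate of v up to the annihilator of p. *)
Lemma card_comb_ker x : primitive x ->
  #|[pred u | comb x u == 0%R]| = (p ^ n * p ^ 3)%N.
Proof.
move=> xP; have shift_inj : injective (shift x).
  move=> [l [[a b] c]] [l' [[a' b'] c']] /eqP.
  rewrite !xpair_eqE /= => /andP[/eqP <-] /andP[/andP[]].
  by rewrite !(inj_eq (addIr _)) => /eqP -> /eqP -> /eqP ->.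
have comb_ker (l z t : R) : pdvd 1 l -> (l * z + p%:R * (t - quo l * z) == 0) = pdvd n t.
  move=> l1; rewrite mulrBr mulrA (quoK l1) addrC subrK.
  by rewrite -[p%:R]expr1 pX_mul_eq0// subn1.
transitivity (#|[predX [pred l : R | pdvd 1 l] & V3 K]|).
  rewrite -[RHS](card_imset _ shift_inj); apply: eq_card => -[l v]; rewrite inE.
  apply/idP/imsetP => [|[[l' [[a b] c]]]]; last first.
    rewrite !inE /= => /andP[l1 abc] [-> ->].
    by rewrite /comb /= !xpair_eqE !comb_ker// -?andbA.
  move=> lv; have l1 : pdvd 1 l.
    apply: contraNT xP => nl; apply/and3P; case: v lv => -[a b] c.
    rewrite /comb /= !xpair_eqE => /andP[/andP[/eqP ha /eqP hb] /eqP hc].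
    have h z t : l * z + p%:R * t = 0 -> pdvd 1 z.
      move/eqP; rewrite addr_eq0 => /eqP lz.
      rewrite -(pdvd_unitM p_pr z (u := l))//; last by rewrite pdvd_unit.
      by rewrite lz pdvdN//; apply/(pdvd1P p_pr); exists t.
    by split; [exact: h ha|exact: h hb|exact: h hc].
  exists (l, (v.1.1 + quo l * x.1.1, v.1.2 + quo l * x.1.2, v.2 + quo l * x.2)).
    have h z t : (l * z + p%:R * t == 0) = pdvd n (t + quo l * z).
      by rewrite -(comb_ker l z)// addrK.
    by case: v lv => -[a b] c; rewrite !inE l1 /comb /= !xpair_eqE !h.
  by case: v lv => -[a b] c _; rewrite /shift /= !addrK.
by rewrite cardX cardV3 cardK cardD1.
Qed.

(** A vector y dependent on x modulo p has the form l x + p v: division by a unit coordinate of x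
    gives l, and the minors divided by p give v. *)
Lemma codom_comb x : primitive x -> forall y, (y \in codom (comb x)) = ~~ independent x y.
Proof.
move=> xP y; rewrite /independent /primitive negbK /=.
apply/codomP/and3P => [[[l [[a b] c]] ->] /=|].
  split; apply/(pdvd1P p_pr).
  - by exists (x.1.1 * b - a * x.1.2); ring.
  - by exists (x.1.1 * c - a * x.2); ring.
  - by exists (x.1.2 * c - b * x.2); ring.
case: x xP => -[a b] c; case: y => -[a' b'] c' /= xP.
move=> [] /(pdvd1P p_pr)[r rE] /(pdvd1P p_pr)[s sE] /(pdvd1P p_pr)[t tE].
have {}xP : [|| a \is a GRing.unit, b \is a GRing.unit | c \is a GRing.unit].
  by move: xP; rewrite /primitive !negb_and /= !pdvd_unit.
case/or3P: xP => [aU|bU|cU].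
- exists (a' / a, (0, r / a, s / a)); rewrite /comb /=; congr (_, _, _).
  + by rewrite mulr0 addr0 divrK.
  + by rewrite mulrA -rE -{1}(mulKr aU b'); ring.
  + by rewrite mulrA -sE -{1}(mulKr aU c'); ring.
- exists (b' / b, (- r / b, 0, t / b)); rewrite /comb /=; congr (_, _, _).
  + by rewrite mulrA mulrN -rE -{1}(mulKr bU a'); ring.
  + by rewrite mulr0 addr0 divrK.
  + by rewrite mulrA -tE -{1}(mulKr bU c'); ring.
- exists (c' / c, (- s / c, - t / c, 0)); rewrite /comb /=; congr (_, _, _).
  + by rewrite mulrA mulrN -sE -{1}(mulKr cU a'); ring.
  + by rewrite mulrA mulrN -tE -{1}(mulKr cU b'); ring.
  + by rewrite mulr0 addr0 divrK.
Qed.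

Lemma sum_dependent x (g : V -> nat) : primitive x ->
  (p ^ n * p ^ 3 * \sum_(y | ~~ independent x y) g y
   = \sum_u g (comb x u))%N.
Proof.
move=> xP; rewrite (sum_additive (phi := comb x)) => [|u v]; last first.
  by congr (_, _, _) => /=; ring.
by rewrite card_comb_ker//; congr (_ * _)%N; apply: eq_bigl => y; rewrite codom_comb.
Qed.

Definition count_res j := (\sum_x \sum_y pdvd j (@bres R x y))%N.
Definition count_prim j := (\sum_(x | primitive x) \sum_y pdvd j (@bres R x y))%N.
Definition count_indep j :=
  (\sum_x \sum_(y | independent x y) pdvd j (@bres R x y))%N.

(** The resultant is quadratic in x, so passing from x to p x multiplies it by p^2 and lowers the
    exponent by 2. *)
Lemma count_res_rec j : (j <= n.+1)%N ->
  (p ^ 3 * count_res j = count_res (j - 2) + p ^ 3 * count_prim j)%N.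
Proof.
move=> jn; rewrite {1}/count_res (bigID primitive) /= mulnDr addnC.
rewrite sum_nonprimitive; congr (_ + _)%N; apply: eq_bigr => x _.
apply: eq_bigr => y _; rewrite -pdvd_pM//; congr (nat_of_bool (pdvd j _)).
by rewrite /bres /pmul /=; ring.
Qed.

Lemma independent_primitive x y : independent x y -> primitive x.
Proof.
apply: contra => /and3P[ha hb hc]; apply/and3P.
by split; apply: pdvdB => //; by [exact: pdvdMl|exact: pdvdMr].
Qed.

(** For y = l x + p v the resultant is p^2 [bres x v], whatever l is. The q values of l cancel
    against the kernel of [comb x], of order q p^2, which leaves p^2. *)
Lemma count_prim_rec j : (j <= n.+1)%N ->
  (p ^ 2 * count_prim j = count_prim (j - 2) + p ^ 2 * count_indep j)%N.
Proof.
move=> jn; have -> : count_indep j =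
    (\sum_(x | primitive x) \sum_(y | independent x y) pdvd j (@bres R x y))%N.
  rewrite /count_indep (bigID primitive) /= addnC big1 ?add0n// => x xP.
  by rewrite big_pred0// => y; apply: contraNF xP; exact: independent_primitive.
rewrite /count_prim !big_distrr -big_split; apply: eq_bigr => x xP /=.
rewrite (bigID (independent x)) /= mulnDr addnC; congr (_ + _)%N.
apply/eqP; rewrite -(eqn_pmul2l (m := q)) ?expn_gt0 ?prime_gt0//.
rewrite mulnA (_ : q * p ^ 2 = p ^ n * p ^ 3)%N; last by rewrite -!expnD addSnnS.
rewrite sum_dependent//.
rewrite -(pair_big xpredT xpredT (fun l v => nat_of_bool (pdvd j (bres x (comb x (l, v)))))) /=.
apply/eqP; rewrite -[X in (X * _)%N](card_R p_pr) -sum_nat_const; apply: eq_bigr => l _.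
apply: eq_bigr => y _; rewrite -pdvd_pM//; congr (nat_of_bool (pdvd j _)).
by rewrite /bres /comb /=; ring.
Qed.

Local Notation W := (R * R)%type.
Let det2 (A B : W) : R := A.1 * B.2 - A.2 * B.1.

Lemma sum_linear (A B : W) (g : W -> nat) : det2 A B \is a GRing.unit ->
  (\sum_C g C = \sum_(y : R) \sum_(x : R) g (x * A.1 + y * B.1, x * A.2 + y * B.2)%R)%N.
Proof.
move=> dU; rewrite exchange_big pair_bigA /=.
apply: (reindex_inj (h := fun u : W => (u.1 * A.1 + u.2 * B.1, u.1 * A.2 + u.2 * B.2))).
move=> [x y] [x' y'] /eqP; rewrite xpair_eqE /= => /andP[/eqP h1 /eqP h2].
congr pair; apply: (mulIr dU); rewrite /det2.
  transitivity ((x * A.1 + y * B.1) * B.2 - (x * A.2 + y * B.2) * B.1); first by ring.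
  by rewrite h1 h2; ring.
transitivity ((x * A.2 + y * B.2) * A.1 - (x * A.1 + y * B.1) * A.2); first by ring.
by rewrite h1 h2; ring.
Qed.

Let GL2 := (\sum_(A : W) \sum_(B : W) (det2 A B \is a GRing.unit))%N.

Let sum_units : (\sum_(a : R) (a \is a GRing.unit) = p ^ n * p.-1)%N.
Proof.
rewrite -card_units -sum1_card [RHS]big_mkcond; apply: eq_bigr => a _.
by rewrite inE; case: (a \in _).
Qed.

Let sum_constR (F : R -> nat) (k : nat) : (forall a, F a = k) ->
  (\sum_(a : R) F a = q * k)%N.
Proof.
by move=> Fk; rewrite (eq_bigr (fun=> k)) ?sum_nat_const ?card_R// => a _; exact: Fk.
Qed.

(** If [a] is a unit, then for all [a'] and [b] the determinant runs through [R] as [b'] does;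
    otherwise it is a unit exactly when [a'] and [b] both are. *)
Lemma card_GL2 : (GL2 = p ^ n * p.-1 * (p ^ n * p.-1) * (p ^ n * p) * (p ^ n * p.+1))%N.
Proof.
have GL2E : GL2 = (\sum_(a : R) \sum_(a' : R) \sum_(b : R) \sum_(b' : R)
    ((a * b' - a' * b)%R \is a GRing.unit))%N.
  rewrite /GL2 [RHS]pair_bigA; apply: eq_bigr => -[a a'] _.
  by rewrite [RHS]pair_bigA; apply: eq_bigr => -[b b'].
rewrite GL2E (bigID (fun a => a \is a GRing.unit)) /=.
rewrite (eq_bigr (fun=> q * (q * (p ^ n * p.-1)))%N); last first.
  move=> a aU; apply: sum_constR => a'; apply: sum_constR => b; rewrite -sum_units.
  have inj : injective (fun b' : R => b' / a + a' * b / a).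
    by move=> x y /addIr; apply: mulIr; rewrite unitrV.
  rewrite (reindex_inj inj); apply: eq_bigr => b' _.
  by rewrite mulrDr -!mulrA !(mulrCA a) divrr// !mulr1 addrK.
rewrite [X in (_ + X)%N](eq_bigr (fun=> p ^ n * p.-1 * (p ^ n * p.-1 * q))%N); last first.
  move=> a; rewrite pdvd_unit// negbK => aP.
  rewrite -{1}sum_units big_distrl /=; apply: eq_bigr => a' _.
  rewrite -sum_units !big_distrl big_distrr /=; apply: eq_bigr => b _.
  rewrite mulnA [RHS]mulnC; apply: sum_constR => b'.
  rewrite !pdvd_unit// addrC pdvd_addl//; last exact: pdvdMl.
  by rewrite pdvdN// pdvd1M// negb_or mulnb.
have sumU k : (\sum_(a : R | a \is a GRing.unit) k = p ^ n * p.-1 * k)%N.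
  by rewrite sum_nat_const -card_units; congr (_ * _)%N; apply: eq_card.
have sumN k : (\sum_(a : R | a \isn't a GRing.unit) k = p ^ n * k)%N.
  rewrite sum_nat_const -cardD1; congr (_ * _)%N; apply: eq_card => a.
  by rewrite -[LHS]/(a \isn't a GRing.unit) pdvd_unit// negbK.
rewrite sumU sumN.
rewrite expnS; ring.
Qed.

(* With A, B, C the columns of the matrix of coefficients, the resultant is
   Q A B C = [AC]^2 - [AB][BC].  When [AB] is a unit, it is up to a unit of the
   form t + y^2 in the coordinates of C; when only [BC] is, swap A and C. *)
Lemma count_indep_val j : (0 < j <= n.+1)%N ->
  (p ^ j * p * count_indep j = GL2 * q ^ 2 * p.+1)%N.
Proof.
move=> /andP[j0 jn].
pose Q (A B C : W) := (det2 A C) ^+ 2 - det2 A B * det2 B C.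
have sumD (z : R) : (p ^ j * \sum_(t : R) pdvd j (t + z)%R = q)%N.
  rewrite (reindex_inj (addIr (- z))) /=.
  rewrite (eq_bigr (fun t => nat_of_bool (pdvd j t))); last by move=> t _; rewrite addrNK.
  transitivity (#|[pred x : R | pdvd j x]| * p ^ j)%N; last exact: card_pdvd.
  rewrite mulnC; congr (_ * _)%N.
  by rewrite -sum1_card [RHS]big_mkcond; apply: eq_bigr => t _; rewrite inE; case: ifP.
have U1 (A B : W) : det2 A B \is a GRing.unit ->
    (p ^ j * \sum_C pdvd j (Q A B C) = q ^ 2)%N.
  move=> dU; rewrite (sum_linear _ dU) big_distrr /= -mulnn; apply: sum_constR => y.
  apply: etrans (sumD (y ^+ 2)); congr (_ * _)%N; apply: eq_bigr => x _.
  rewrite -(pdvd_unitM p_pr (x + y ^+ 2) jn (unitrX 2 dU)).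
  by congr (nat_of_bool (pdvd j _)); rewrite /Q /det2 /=; ring.
have U2 (B C : W) : det2 B C \is a GRing.unit ->
    (p ^ j * p * \sum_A (pdvd 1 (det2 A B) && pdvd j (Q A B C)) = q ^ 2)%N.
  move=> dU; rewrite (sum_linear _ dU) exchange_big /=.
  rewrite (bigID (pdvd 1)) /= [X in (_ + X)%N]big1 ?addn0; last first.
    move=> x xP; rewrite big1// => y _; apply/eqP; rewrite eqb0.
    apply: contra xP => /andP[].
    rewrite (_ : det2 _ _ = det2 B C * - y); last by rewrite /det2 /=; ring.
    rewrite pdvd_unitM// => y1; rewrite /Q.
    rewrite (_ : _ - _ = det2 B C ^+ 2 * (x ^+ 2 + y)); last by rewrite /det2 /=; ring.
    rewrite pdvd_unitM ?unitrX// => /(pdvdW j0).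
    by rewrite pdvdN// in y1; rewrite pdvd_addl// expr2 pdvd1M// orbb.
  rewrite mulnAC big_distrr /= (eq_bigr (fun=> q)); last first.
    move=> x x1; apply: etrans (sumD (x ^+ 2)); congr (_ * _)%N; apply: eq_bigr => y _.
    rewrite (_ : det2 _ _ = det2 B C * - y); last by rewrite /det2 /=; ring.
    rewrite (_ : Q _ _ _ = det2 B C ^+ 2 * (y + x ^+ 2)); last by rewrite /Q /det2 /=; ring.
    rewrite !pdvd_unitM ?unitrX// pdvdN//; case/boolP: (pdvd j _) => jy; rewrite ?andbF// andbT.
    rewrite -(pdvd_addl p_pr y (j := 1) (y := x ^+ 2))//; last by rewrite expr2; apply: pdvdMl.
    by rewrite (pdvdW j0 jy).
  rewrite sum_nat_const (_ : #|_| = p ^ n)%N; last by rewrite -cardD1; apply: eq_card.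
  by rewrite mulnAC -expnSr mulnn.
(* If neither [AB] nor [BC] is a unit, p | Q forces p | [AC], contrary to independence. The two
   summands are the remaining cases, made disjoint. *)
have -> : count_indep j = (\sum_(A : W) \sum_(B : W) \sum_(C : W)
    (((det2 A B \is a GRing.unit) && pdvd j (Q A B C)) +
     ((det2 B C \is a GRing.unit) && (pdvd 1 (det2 A B) && pdvd j (Q A B C)))))%N.
  pose f (u : W * W * W) : V * V := (u.1.1.1, u.1.2.1, u.2.1, (u.1.1.2, u.1.2.2, u.2.2)).
  have fbij : bijective f.
    exists (fun u : V * V => (u.1.1.1, u.2.1.1, (u.1.1.2, u.2.1.2), (u.1.2, u.2.2))).
      by move=> [[[? ?] [? ?]] [? ?]].
    by move=> [[[? ?] ?] [[? ?] ?]].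
  rewrite /count_indep.
  under eq_bigr do rewrite big_mkcond.
  rewrite pair_bigA (reindex f) /=; last exact: onW_bij.
  rewrite pair_bigA pair_bigA; apply: eq_bigr => -[[A B] C] _ /=.
  rewrite /independent /primitive /bres /= -/(det2 A B) -/(det2 A C) -/(det2 B C).
  rewrite -/(Q A B C) !pdvd_unit//.
  case/boolP : (pdvd j (Q A B C)) => jQ; last by rewrite !andbF if_same.
  rewrite !andbT; case/boolP : (pdvd 1 (det2 A B)) => AB //=; last by rewrite andbF.
  rewrite andbT; case/boolP : (pdvd 1 (det2 B C)) => BC //=; last by rewrite andbF.
  rewrite andbT; suff -> : pdvd 1 (det2 A C) by [].
  move: (pdvdW j0 jQ); rewrite /Q pdvd_addl//; last by rewrite pdvdN//; exact: pdvdMl.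
  by rewrite expr2 pdvd1M// orbb.
under eq_bigr do under eq_bigr do rewrite big_split.
under eq_bigr do rewrite big_split.
(* In p + 1, the term p comes from [AB] being a unit and the term 1 from the other case. *)
rewrite big_split /= mulnDr mulnS addnC; congr (_ + _)%N.
  rewrite exchange_big /=; under eq_bigr do rewrite exchange_big.
  rewrite /GL2 big_distrr big_distrl /=; apply: eq_bigr => B _.
  rewrite big_distrr big_distrl /=; apply: eq_bigr => C _.
  case/boolP : (det2 B C \is a GRing.unit) => BC /=; first by rewrite U2// mul1n.
  by rewrite big1 ?muln0.
rewrite -mulnA mulnCA [RHS]mulnC; congr (_ * _)%N.
rewrite /GL2 big_distrr big_distrl /=; apply: eq_bigr => A _.
rewrite big_distrr big_distrl /=; apply: eq_bigr => B _.
case/boolP : (det2 A B \is a GRing.unit) => AB /=; first by rewrite U1// mul1n.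
by rewrite big1 ?muln0.
Qed.

Lemma count_res0 : count_res 0 = (q ^ 6)%N.
Proof.
rewrite /count_res; under eq_bigr do under eq_bigr do rewrite pdvdT.
under eq_bigr do rewrite sum_nat_const muln1.
rewrite sum_nat_const !card_prod card_R//; ring.
Qed.

Lemma count_indepE j : (0 < j <= n.+1)%N ->
  (p ^ j * p * count_indep j
   = p ^ n * p.-1 * (p ^ n * p.-1) * (p ^ n * p) * (p ^ n * p.+1) * q ^ 2 * p.+1)%N.
Proof. by move=> /count_indep_val ->; rewrite card_GL2. Qed.

End ResultantCount.

(** * The law of the valuation of the resultant *)

Section ResultantProbability.
Variables (F : realFieldType) (p : nat) (p_pr : prime p).
Local Notation r := (p%:R^-1 : F).

(** The probability that x is primitive and p^j divides the resultant; by [count_primE] it is the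
    same at all levels with j <= n + 1. The term (1 - r^2)^2 r^j is the share of the pairs
    independent modulo p. The case 1 stands apart because [j - 2] is truncated there. *)
Fixpoint prob_prim (j : nat) : F :=
  match j with
  | 0 => 1 - r ^+ 3
  | 1 => r ^+ 2 * (1 - r ^+ 3) + (1 - r ^+ 2) ^+ 2 * r
  | j'.+2 => r ^+ 2 * prob_prim j' + (1 - r ^+ 2) ^+ 2 * r ^+ j
  end.

Fixpoint prob_res (j : nat) : F :=
  match j with
  | 0 => 1
  | 1 => r ^+ 3 + prob_prim 1
  | j'.+2 => r ^+ 3 * prob_res j' + prob_prim j
  end.

Let pU : (p%:R : F) != 0.
Proof. by rewrite pnatr_eq0 -lt0n prime_gt0. Qed.

Lemma count_primE n j : (j <= n.+1)%N ->
  (count_prim p n j)%:R = (p ^ n.+1)%:R ^+ 6 * prob_prim j.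
Proof.
have indepE i : (0 < i <= n.+1)%N -> (count_indep p n i)%:R =
    (p ^ n.+1)%:R ^+ 6 * ((1 - r ^+ 2) ^+ 2 * r ^+ i).
  move=> /(count_indepE p_pr) /(congr1 (fun k => k%:R : F)).
  rewrite !natrM !natrX -[p.+1]addn1 natrD -subn1 natrB ?prime_gt0//.
  rewrite exprS => h.
  have pi0 : (p%:R ^+ i * p%:R : F) != 0 by rewrite mulf_neq0// expf_neq0.
  apply: (mulfI pi0); rewrite h !exprVn; field.
  by rewrite pU expf_neq0.
have p2U : (p%:R ^+ 2 : F) != 0 by rewrite expf_neq0.
have recE i : (i <= n.+1)%N -> p%:R ^+ 2 * (count_prim p n i)%:R =
    (count_prim p n (i - 2))%:R + p%:R ^+ 2 * (count_indep p n i)%:R :> F.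
  move=> /(count_prim_rec p_pr) /(congr1 (fun k => k%:R : F)).
  by rewrite natrD !natrM expr2.
have prim0 : (count_prim p n 0)%:R = (p ^ n.+1)%:R ^+ 6 * (1 - r ^+ 3).
  (* At j = 0 the truncated [j - 2] is 0 again, so the recursion can be solved for [count_prim]. *)
  have /(congr1 (fun k => k%:R : F)) := count_res_rec p_pr (leq0n n.+1).
  rewrite count_res0// natrD !natrM !natrX => h.
  apply: (mulfI (_ : (p%:R ^+ 3 : F) != 0)); first by rewrite expf_neq0.
  transitivity (p%:R ^+ 3 * (p%:R ^+ n.+1) ^+ 6 - (p%:R ^+ n.+1) ^+ 6 : F).
    by move: h; lra.
  by field; rewrite pU.
elim/ltn_ind : j => -[|[|j]] IH jn /=; first exact: prim0.
  apply: (mulfI p2U); rewrite recE// prim0 indepE// expr1; field.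
  by rewrite pU.
apply: (mulfI p2U); rewrite recE// !subSS subn0 IH ?(ltnW (ltnW jn))// ?indepE//.
by field; rewrite pU.
Qed.

Lemma count_resE n j : (j <= n.+1)%N ->
  (count_res p n j)%:R = (p ^ n.+1)%:R ^+ 6 * prob_res j.
Proof.
have p3U : (p%:R ^+ 3 : F) != 0 by rewrite expf_neq0.
have recE i : (i <= n.+1)%N -> p%:R ^+ 3 * (count_res p n i)%:R =
    (count_res p n (i - 2))%:R + p%:R ^+ 3 * (count_prim p n i)%:R :> F.
  move=> /(count_res_rec p_pr) /(congr1 (fun k => k%:R : F)).
  by rewrite natrD !natrM !exprS expr0 mulr1.
have res0 : (count_res p n 0)%:R = (p ^ n.+1)%:R ^+ 6 :> F by rewrite count_res0// natrX.
elim/ltn_ind : j => -[|[|j]] IH jn; first by rewrite mulr1.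
  apply: (mulfI p3U); rewrite recE// res0 count_primE//.
  by rewrite -[prob_res 1]/(r ^+ 3 + prob_prim 1); field; rewrite pU.
apply: (mulfI p3U); rewrite recE// !subSS subn0 IH ?(ltnW (ltnW jn))// count_primE//.
rewrite -[prob_res j.+2]/(r ^+ 3 * prob_res j + prob_prim j.+2).
by field; rewrite pU.
Qed.

Let r_ge0 : 0 <= r. Proof. by rewrite invr_ge0. Qed.

Let r_half : r <= 1 / 2%:R.
Proof.
by rewrite div1r lef_pV2 ?posrE ?ltr0n ?prime_gt0// ler_nat prime_gt1.
Qed.

Let r_lt1 : r < 1. Proof. by move: r_half; lra. Qed.

Let pow34 j : (3 / 4) ^+ j.+2 = 9 / 16 * (3 / 4) ^+ j :> F.
Proof. by rewrite !exprS mulrA; congr (_ * _); lra. Qed.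

(* The common ratio 3/4 absorbs the recursion because r <= 1/2. *)
Lemma prob_prim_le j : prob_prim j <= 2 * (3 / 4) ^+ j.
Proof.
have r2 : r ^+ 2 <= 1 / 4 by move: r_half r_ge0; rewrite expr2; nra.
have r3 : 0 <= r ^+ 3 by rewrite exprn_ge0.
have r20 : 0 <= r ^+ 2 by rewrite exprn_ge0.
have r22 : (1 - r ^+ 2) ^+ 2 <= 1 by rewrite expr_le1//; lra.
elim/ltn_ind : j => -[|[|j]] IH /=; first by rewrite expr0; lra.
  have : (1 - r ^+ 2) ^+ 2 * r <= 1 * (1 / 2) by apply: ler_pM => //; exact: sqr_ge0.
  have : r ^+ 2 * (1 - r ^+ 3) <= r ^+ 2 * 1 by apply: ler_wpM2l => //; lra.
  by rewrite expr1; lra.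
have h1 : r ^+ 2 * prob_prim j <= 1 / 4 * (2 * (3 / 4) ^+ j).
  apply: le_trans (_ : r ^+ 2 * (2 * (3 / 4) ^+ j) <= _).
    by apply: ler_wpM2l => //; exact: IH.
  by apply: ler_wpM2r => //; rewrite mulr_ge0// exprn_ge0//; lra.
have h2 : (1 - r ^+ 2) ^+ 2 * r ^+ j.+2 <= 1 * (1 / 4 * (3 / 4) ^+ j).
  apply: ler_pM => //; rewrite ?sqr_ge0 ?exprn_ge0//.
  rewrite -addn2 exprD mulrC; apply: ler_pM; rewrite ?exprn_ge0//.
  by apply: lerXn2r; rewrite ?nnegrE//; apply: le_trans r_half _; lra.
have h3 : 0 <= (3 / 4 : F) ^+ j by rewrite exprn_ge0//; lra.
rewrite [(3 / 4) ^+ j.+2]pow34; move: h1 h2 h3.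
by set x := (3 / 4) ^+ j; lra.
Qed.

(** This decay serves twice: it bounds the error of the partial sums of the mean, and it makes the
    probability of a singular zero vanish. *)
Lemma prob_res_le j : prob_res j <= 8%:R * (3 / 4) ^+ j.
Proof.
have r3 : r ^+ 3 <= 1 / 8%:R.
  apply: le_trans (_ : (1 / 2) ^+ 3 <= _); last by lra.
  by apply: lerXn2r; rewrite ?nnegrE//; lra.
have r30 : 0 <= r ^+ 3 by rewrite exprn_ge0.
elim/ltn_ind : j => -[|[|j]] IH; first by rewrite /= expr0; lra.
  have := prob_prim_le 1; rewrite -[prob_res 1]/(r ^+ 3 + prob_prim 1) expr1; lra.
have h1 : r ^+ 3 * prob_res j <= 1 / 8%:R * (8%:R * (3 / 4) ^+ j).
  apply: le_trans (_ : r ^+ 3 * (8%:R * (3 / 4) ^+ j) <= _).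
    by apply: ler_wpM2l => //; exact: IH.
  by apply: ler_wpM2r => //; rewrite mulr_ge0// exprn_ge0//; lra.
have := prob_prim_le j.+2.
rewrite -[prob_res j.+2]/(r ^+ 3 * prob_res j + prob_prim j.+2).
have h3 : 0 <= (3 / 4 : F) ^+ j by rewrite exprn_ge0//; lra.
rewrite [(3 / 4) ^+ j.+2]pow34; move: h1 h3.
by set x := (3 / 4) ^+ j; lra.
Qed.

Lemma prob_res_ge0 j : 0 <= prob_res j.
Proof.
have := ler0n F (count_res p j j); rewrite count_resE//.
by rewrite pmulr_rge0// exprn_gt0// ltr0n expn_gt0 prime_gt0.
Qed.

Lemma prob_prim_ge0 j : 0 <= prob_prim j.
Proof.
have := ler0n F (count_prim p j j); rewrite count_primE//.
by rewrite pmulr_rge0// exprn_gt0// ltr0n expn_gt0 prime_gt0.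
Qed.

Definition mean_res : F := (1 - r) / (1 - r ^+ 5).

(** The differences are the probabilities that the resultant has valuation exactly k, so the sums
    approximate E[p^(-v(Res))]. *)
Lemma sum_prob_res : exists C : F, forall n,
  `|mean_res - \sum_(k < n) r ^+ k * (prob_res k - prob_res k.+1)| <= C * r ^+ n.
Proof.
(* The error after n terms is r^n times a linear combination of the state of
   the recursion; c1, ..., c5 solve the resulting linear system. *)
pose c1 (x : F) := (1 - x ^+ 4) / (1 - x ^+ 5).
pose c2 (x : F) := - (1 - x) / (1 - x ^+ 5).
pose c3 x := x ^+ 3 * c2 x / (1 - x ^+ 4).
pose c4 x := x * c3 x.
pose c5 x := x ^+ 3 * (1 - x ^+ 2) * (c2 x + c4 x).
have d5 : 1 - r ^+ 5 != 0 by rewrite subr_eq0 eq_sym lt_eqF// exprn_ilt1.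
have d4 : 1 - r ^+ 4 != 0 by rewrite subr_eq0 eq_sym lt_eqF// exprn_ilt1.
pose g n := c1 r * prob_res n + c2 r * prob_res n.+1 + c3 r * prob_prim n
  + c4 r * prob_prim n.+1 + c5 r * r ^+ n.
exists (`|c1 r| * 8%:R + `|c2 r| * 8%:R + `|c3 r| * 2 + `|c4 r| * 2 + `|c5 r| * 1) => n.
have -> : mean_res - \sum_(k < n) r ^+ k * (prob_res k - prob_res k.+1) = r ^+ n * g n.
  elim: n => [|n IH].
    rewrite big_ord0 subr0 expr0 mul1r /g expr0 -[prob_res 1]/(r ^+ 3 + prob_prim 1) /=.
    rewrite /c5 /c4 /c3 /c2 /c1 /mean_res; move: d4 d5; move: r => x d4 d5; field.
    by rewrite d4 d5.
  rewrite big_ord_recr opprD addrA IH /g.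
  rewrite -[prob_res n.+2]/(r ^+ 3 * prob_res n + prob_prim n.+2).
  rewrite -[prob_prim n.+2]/(r ^+ 2 * prob_prim n + (1 - r ^+ 2) ^+ 2 * r ^+ n.+2).
  rewrite /c5 /c4 /c3 /c2 /c1 !(exprS r n) !(exprS r n.+1) !(exprS r n).
  move: (prob_res n) (prob_res n.+1) (prob_prim n) (prob_prim n.+1) => a0 a1 t0 t1.
  move: d4 d5 (r ^+ n); move: r => x d4 d5 y; field.
  by rewrite d4 d5.
have pow1 : (3 / 4 : F) ^+ n <= 1 by rewrite exprn_ile1//; lra.
have pow1S : (3 / 4 : F) ^+ n.+1 <= 1 by rewrite exprn_ile1//; lra.
have bd (c a b : F) : 0 <= a -> a <= b -> `|c * a| <= `|c| * b.
  by move=> a0 ab; rewrite normrM (ger0_norm a0) ler_wpM2l.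
rewrite normrM ger0_norm ?exprn_ge0// mulrC ler_wpM2r ?exprn_ge0//.
have tri (a b a' b' : F) : `|a| <= a' -> `|b| <= b' -> `|a + b| <= a' + b'.
  by move=> aa' bb'; apply: le_trans (ler_normD _ _) _; exact: lerD.
have := (prob_res_le n, prob_res_le n.+1, prob_prim_le n, prob_prim_le n.+1).
move=> [[[a0 a1] t0] t1].
by rewrite /g; apply: (tri); [apply: (tri); [apply: (tri); [apply: (tri)|]|]|]; apply: (bd);
  rewrite ?prob_res_ge0 ?prob_prim_ge0 ?exprn_ge0 ?(exprn_ile1 _ r_ge0 (ltW r_lt1))//; lra.
Qed.

End ResultantProbability.

(** * The restriction of a cubic form to a line *)

Notation o2 := (@Ordinal 4 2 isT).
Notation o3 := (@Ordinal 4 3 isT).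

(** Adjacent transpositions generate the symmetric group. This is needed because the indices
    attached to a monomial are known only up to order. *)
Lemma perm_eq3 (T : eqType) (S : Type) (s : T -> T -> T -> S) :
  (forall i j k, s i j k = s j i k) -> (forall i j k, s i j k = s i k j) ->
  forall i j k i' j' k', perm_eq [:: i; j; k] [:: i'; j'; k'] ->
  s i j k = s i' j' k'.
Proof.
move=> s12 s23.
have perm2 (j k j' k' : T) : perm_eq [:: j; k] [:: j'; k'] ->
    (j = j' /\ k = k') \/ (j = k' /\ k = j').
  move=> h; have := perm_mem h j; rewrite !inE eqxx /= => /esym/orP[]/eqP jE.
    left; split=> //; move: h; rewrite jE perm_cons => /perm_mem/(_ k).
    by rewrite !inE eqxx => /esym/eqP.
  right; split=> //; move: h; rewrite jE perm_sym (perm_catC [:: j'] [:: k']) /=.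
  by rewrite perm_cons => /perm_mem/(_ k); rewrite !inE eqxx => /eqP.
move=> i j k i' j' k' h; have := perm_mem h i.
rewrite !inE eqxx /= => /esym/or3P[]/eqP iE; move: h; rewrite iE.
- by rewrite perm_cons => /perm2[[-> ->]|[-> ->]].
- rewrite perm_sym (perm_catCA [:: i'] [:: j'] [:: k']) /= perm_cons => /perm2[[-> ->]|[-> ->]]//.
  by rewrite s23 s12.
- rewrite perm_sym (perm_catC [:: i'; j'] [:: k']) /= perm_cons => /perm2[[-> ->]|[-> ->]].
    by rewrite s12 s23.
  by rewrite s12 s23 s12.
Qed.

(** Entries given by a function on [nat] let the iterated Laplace expansion in [det_sylv] reduce by
    computation. *)
Lemma det_nat_expand (S : comNzRingType) n (g : nat -> nat -> S) :
  \det (\matrix_(i < n.+1, j < n.+1) g i j) =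
  \sum_(j < n.+1) g 0%N j * ((-1) ^+ j *
    \det (\matrix_(i < n, k < n) g i.+1 (bump j k))).
Proof.
rewrite (expand_det_row _ ord0); apply: eq_bigr => j _.
rewrite mxE /cofactor add0n; congr (_ * (_ * \det _)).
by apply/matrixP => i k; rewrite !mxE.
Qed.

(* A cubic form has a coefficient c m for each monomial m, written as the product
   of the variables of indices i1 m, i2 m and i3 m, so that a permutation of the
   variables amounts to composing i1, i2 and i3 with it. *)
Section CubicForm.
Variables (M : finType) (i1 i2 i3 : M -> 'I_4).

Section Ring.
Variable S : comNzRingType.
Implicit Types (c : M -> S) (u v w d : 'I_4 -> S) (A h : 'rV[S]_4).

(** This trilinear form depends on the order chosen in each monomial. [cub], [dcub] and [pol],
    namely the cubic form, its directional derivative and its full polarization, do not, and they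
    involve no division by 2 or 3. *)
Definition tri c u v w := \sum_m c m * (u (i1 m) * v (i2 m) * w (i3 m)).
Definition cub c v := tri c v v v.
Definition dcub c v d := tri c d v v + tri c v d v + tri c v v d.
Definition pol c u v w :=
  tri c u v w + tri c u w v + tri c v u w + tri c v w u + tri c w u v + tri c w v u.

Definition e2 (i : 'I_4) : S := (i == o2)%:R.
Definition e3 (i : 'I_4) : S := (i == o3)%:R.

(* The matrix A = (a, b, c, d) encodes the line through (1, 0, a, c) and
   (0, 1, b, d). *)
Definition uvec A (i : 'I_4) : S := nth 0 [:: 1; 0; A 0 0; A 0 o2] i.
Definition wvec A (i : 'I_4) : S := nth 0 [:: 0; 1; A 0 1; A 0 o3] i.

(* The coefficients of the binary cubic form F(s u + t w). *)
Definition restr c A : 'rV[S]_4 := \row_j nth 0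
  [:: cub c (uvec A); dcub c (uvec A) (wvec A); dcub c (wvec A) (uvec A);
      cub c (wvec A)] j.

(* The coefficients of the binary quadratic form D_e F(s u + t w). *)
Definition normal_quadric e c A : S * S * S :=
  (dcub c (uvec A) e, pol c (uvec A) (wvec A) e, dcub c (wvec A) e).

Definition sylv (x y : S * S * S) : 'M[S]_4 := \matrix_(i, j) nth 0 (nth [::]
  [:: [:: x.1.1; x.1.2; x.2; 0]; [:: 0; x.1.1; x.1.2; x.2];
      [:: y.1.1; y.1.2; y.2; 0]; [:: 0; y.1.1; y.1.2; y.2]] i) j.

Definition jac c A := sylv (normal_quadric e2 c A) (normal_quadric e3 c A).

Lemma det_sylv x y : \det (sylv x y) = bres x y.
Proof.
case: x => -[a b] c; case: y => -[a' b'] c'.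
rewrite /sylv.
pose g (i j : nat) : S := nth 0 (nth [::] [:: [:: a; b; c; 0]; [:: 0; a; b; c];
  [:: a'; b'; c'; 0]; [:: 0; a'; b'; c']] i) j.
rewrite -[LHS]/(\det (\matrix_(i < 4, j < 4) g i j)) det_nat_expand.
under eq_bigr => j1 _.
  rewrite (det_nat_expand 2 (fun i k => g i.+1 (bump j1 k))).
  under eq_bigr => j2 _.
    rewrite (det_nat_expand 1 (fun i k => g i.+2 (bump j1 (bump j2 k)))).
    under eq_bigr => j3 _ do rewrite det_mx11 mxE.
    over.
  over.
rewrite !big_ord_recl !big_ord0 /= /bump /= !add0n !addn0 !add1n /g /bres /=; ring.
Qed.

Lemma cub_taylor c u d t : cub c (fun i => u i + t * d i) =
  cub c u + t * dcub c u d + t ^+ 2 * (dcub c d u + t * cub c d).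
Proof.
rewrite /cub /dcub /tri !(mulrDr, mulr_sumr) -!big_split /=.
by apply: eq_bigr => m _; ring.
Qed.

Lemma dcub_taylor c u v d e t :
  dcub c (fun i => u i + t * d i) (fun i => v i + t * e i) =
  dcub c u v + t * (dcub c u e + pol c u v d)
  + t ^+ 2 * (dcub c d v + pol c u d e + t * dcub c d e).
Proof.
rewrite /dcub /pol /tri !(mulrDr, mulr_sumr) -!big_split /=.
by apply: eq_bigr => m _; ring.
Qed.

Lemma dcub_lin c v (a b : S) x y :
  dcub c v (fun i => a * x i + b * y i) = a * dcub c v x + b * dcub c v y.
Proof.
rewrite /dcub /tri !(mulrDr, mulr_sumr) -!big_split /=.
by apply: eq_bigr => m _; ring.
Qed.

Lemma pol_lin c u v (a b : S) x y :
  pol c u v (fun i => a * x i + b * y i) = a * pol c u v x + b * pol c u v y.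
Proof.
rewrite /pol /tri !(mulrDr, mulr_sumr) -!big_split /=.
by apply: eq_bigr => m _; ring.
Qed.

Lemma polC c u v w : pol c u v w = pol c v u w.
Proof. rewrite /pol; ring. Qed.

Lemma uvecD A h t : uvec (A + t *: h) =
  fun i => uvec A i + t * (h 0 0 * e2 i + h 0 o2 * e3 i).
Proof.
apply/funext => -[[|[|[|[|//]]]] ?];
  rewrite /uvec /e2 /e3 /= ?mxE -?val_eqE /= ?mulr0 ?mulr1 ?addr0 ?add0r //=; ring.
Qed.

Lemma wvecD A h t : wvec (A + t *: h) =
  fun i => wvec A i + t * (h 0 1 * e2 i + h 0 o3 * e3 i).
Proof.
apply/funext => -[[|[|[|[|//]]]] ?];
  rewrite /wvec /e2 /e3 /= ?mxE -?val_eqE /= ?mulr0 ?mulr1 ?addr0 ?add0r //=; ring.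
Qed.

Lemma mul_sylv h x y : h *m sylv x y = \row_j nth 0
  [:: h 0 0 * x.1.1 + h 0 o2 * y.1.1;
      h 0 0 * x.1.2 + h 0 1 * x.1.1 + (h 0 o2 * y.1.2 + h 0 o3 * y.1.1);
      h 0 0 * x.2 + h 0 1 * x.1.2 + (h 0 o2 * y.2 + h 0 o3 * y.1.2);
      h 0 1 * x.2 + h 0 o3 * y.2] j.
Proof.
apply/rowP => j; rewrite !mxE !big_ord_recl big_ord0 !mxE /=.
rewrite (_ : lift ord0 ord0 = 1); last exact: val_inj.
rewrite (_ : lift ord0 (lift ord0 ord0) = o2); last exact: val_inj.
rewrite (_ : lift ord0 (lift ord0 (lift ord0 ord0)) = o3); last exact: val_inj.
by case: j => -[|[|[|[|//]]]] ? /=; ring.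
Qed.

(** A displacement h moves s u + t w by (h0 s + h1 t) e2 + (h2 s + h3 t) e3. The first variation of
    F is therefore (h0 s + h1 t) times the first quadric plus (h2 s + h3 t) times the second, which
    is multiplication by the Sylvester matrix. *)
Lemma restr_taylor c A h t : exists G : 'rV[S]_4,
  restr c (A + t *: h) = restr c A + t *: (h *m jac c A) + t ^+ 2 *: G.
Proof.
pose d i := h 0 0 * e2 i + h 0 o2 * e3 i.
pose e i := h 0 1 * e2 i + h 0 o3 * e3 i.
exists (\row_j nth 0
  [:: dcub c d (uvec A) + t * cub c d;
      dcub c d (wvec A) + pol c (uvec A) d e + t * dcub c d e;
      dcub c e (uvec A) + pol c (wvec A) e d + t * dcub c e d;
      dcub c e (wvec A) + t * cub c e] j).
rewrite /restr uvecD wvecD -/d -/e mul_sylv.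
apply/rowP => j; rewrite !mxE; case: j => -[|[|[|[|//]]]] ? /=.
- by rewrite cub_taylor dcub_lin mulrDr.
- by rewrite dcub_taylor dcub_lin pol_lin; ring.
- by rewrite dcub_taylor dcub_lin pol_lin !(polC _ (wvec A)); ring.
- by rewrite cub_taylor dcub_lin; ring.
Qed.

End Ring.

Section Morphism.
Variables (S S' : comNzRingType) (f : {rmorphism S -> S'}).
Implicit Types (c : M -> S) (u v w : 'I_4 -> S) (A : 'rV[S]_4).

Lemma rmorph_tri c u v w :
  tri (f \o c) (f \o u) (f \o v) (f \o w) = f (tri c u v w).
Proof. by rewrite /tri rmorph_sum; apply: eq_bigr => m _; rewrite !rmorphM. Qed.

Lemma rmorph_uvec A : uvec (map_mx f A) = f \o uvec A.
Proof.
apply/funext => -[[|[|[|[|//]]]] ?];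
  by rewrite /uvec /= ?mxE ?rmorph0 ?rmorph1.
Qed.

Lemma rmorph_wvec A : wvec (map_mx f A) = f \o wvec A.
Proof.
apply/funext => -[[|[|[|[|//]]]] ?];
  by rewrite /wvec /= ?mxE ?rmorph0 ?rmorph1.
Qed.

Lemma rmorph_restr c A : restr (f \o c) (map_mx f A) = map_mx f (restr c A).
Proof.
apply/rowP => j; rewrite !mxE rmorph_uvec rmorph_wvec /cub /dcub !rmorph_tri.
by case: j => -[|[|[|[|//]]]] ? /=; rewrite ?rmorphD.
Qed.

Lemma rmorph_jac c A : jac (f \o c) (map_mx f A) = map_mx f (jac c A).
Proof.
have e2E : e2 S' = f \o e2 S by apply/funext => i; rewrite /e2 /= rmorph_nat.
have e3E : e3 S' = f \o e3 S by apply/funext => i; rewrite /e3 /= rmorph_nat.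
rewrite /jac /normal_quadric rmorph_uvec rmorph_wvec e2E e3E /dcub /pol.
rewrite !rmorph_tri; apply/matrixP => i j; rewrite !mxE.
case: i => -[|[|[|[|//]]]] ? /=; case: j => -[|[|[|[|//]]]] ? /=;
  by rewrite ?rmorphD ?rmorph0.
Qed.

End Morphism.

Section Linear.
Variables (S : comNzRingType).
Implicit Types (c : M -> S) (u v w : 'I_4 -> S) (k : S).

Lemma tri_lin k c c' u v w :
  tri (fun m => k * c m + c' m) u v w = k * tri c u v w + tri c' u v w.
Proof.
rewrite /tri mulr_sumr -big_split; apply: eq_bigr => m _ /=; ring.
Qed.

Lemma cub_linl k c c' v :
  cub (fun m => k * c m + c' m) v = k * cub c v + cub c' v.
Proof. exact: tri_lin. Qed.

Lemma dcub_linl k c c' v w :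
  dcub (fun m => k * c m + c' m) v w = k * dcub c v w + dcub c' v w.
Proof. rewrite /dcub !tri_lin; ring. Qed.

Lemma pol_linl k c c' u v w :
  pol (fun m => k * c m + c' m) u v w = k * pol c u v w + pol c' u v w.
Proof. rewrite /pol !tri_lin; ring. Qed.

End Linear.

Section Product.
Variable mono : 'I_4 -> 'I_4 -> 'I_4 -> M.
Hypothesis monoP : forall i j k, perm_eq
  [:: i1 (mono i j k); i2 (mono i j k); i3 (mono i j k)] [:: i; j; k].
Variable S : comNzRingType.
Implicit Types (l u v w : 'I_4 -> S) (A : 'rV[S]_4).

Definition lin l v := \sum_i l i * v i.

(** The coefficients of the product of three linear forms. *)
Definition prod3 (l1 l2 l3 : 'I_4 -> S) (m : M) : S :=
  \sum_(t : 'I_4 * 'I_4 * 'I_4 | mono t.1.1 t.1.2 t.2 == m)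
    l1 t.1.1 * l2 t.1.2 * l3 t.2.

Lemma sum_prod3 l1 l2 l3 (s : 'I_4 -> 'I_4 -> 'I_4 -> S) :
  (forall i j k, s i j k = s j i k) -> (forall i j k, s i j k = s i k j) ->
  \sum_m prod3 l1 l2 l3 m * s (i1 m) (i2 m) (i3 m) =
  \sum_i \sum_j \sum_k l1 i * l2 j * l3 k * s i j k.
Proof.
move=> s12 s23; rewrite pair_bigA pair_bigA /=.
rewrite [RHS](partition_big (fun t => mono t.1.1 t.1.2 t.2) xpredT)//=.
apply: eq_bigr => m _; rewrite mulr_suml; apply: eq_bigr => -[[i j] k] /= /eqP <-.
by congr (_ * _); apply: (perm_eq3 s12 s23); exact: monoP.
Qed.

Lemma sum_lin3 l1 l2 l3 u v w :
  \sum_i \sum_j \sum_k l1 i * l2 j * l3 k * (u i * v j * w k) =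
  lin l1 u * lin l2 v * lin l3 w.
Proof.
rewrite /lin mulr_suml big_distrl /=; apply: eq_bigr => i _.
rewrite [l1 i * u i * _]mulr_sumr mulr_suml; apply: eq_bigr => j _.
by rewrite mulr_sumr; apply: eq_bigr => k _; ring.
Qed.

Lemma cub_prod3 l1 l2 l3 v :
  cub (prod3 l1 l2 l3) v = lin l1 v * lin l2 v * lin l3 v.
Proof.
rewrite /cub /tri (sum_prod3 _ _ _ (s := fun i j k => v i * v j * v k)) ?sum_lin3//.
  by move=> i j k; ring.
by move=> i j k; ring.
Qed.

Lemma pol_prod3 l1 l2 l3 u v w : pol (prod3 l1 l2 l3) u v w =
  lin l1 u * lin l2 v * lin l3 w + lin l1 u * lin l2 w * lin l3 v +
  lin l1 v * lin l2 u * lin l3 w + lin l1 v * lin l2 w * lin l3 u +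
  lin l1 w * lin l2 u * lin l3 v + lin l1 w * lin l2 v * lin l3 u.
Proof.
rewrite /pol /tri -!big_split /=; under eq_bigr do rewrite -!mulrDr.
rewrite (sum_prod3 _ _ _ (s := fun i j k =>
  u i * v j * w k + u i * w j * v k + v i * u j * w k + v i * w j * u k +
  w i * u j * v k + w i * v j * u k)).
- under eq_bigr do under eq_bigr do under eq_bigr do rewrite !mulrDr.
  under eq_bigr do under eq_bigr do rewrite !big_split.
  under eq_bigr do rewrite !big_split.
  by rewrite !big_split /= !sum_lin3.
- by move=> i j k; ring.
- by move=> i j k; ring.
Qed.

Lemma dcub_prod3 l1 l2 l3 v d : dcub (prod3 l1 l2 l3) v d =
  lin l1 d * lin l2 v * lin l3 v + lin l1 v * lin l2 d * lin l3 v +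
  lin l1 v * lin l2 v * lin l3 d.
Proof.
rewrite /dcub /tri -!big_split /=; under eq_bigr do rewrite -!mulrDr.
rewrite (sum_prod3 _ _ _ (s := fun i j k =>
  d i * v j * v k + v i * d j * v k + v i * v j * d k)).
- under eq_bigr do under eq_bigr do under eq_bigr do rewrite !mulrDr.
  under eq_bigr do under eq_bigr do rewrite !big_split.
  under eq_bigr do rewrite !big_split.
  by rewrite !big_split /= !sum_lin3.
- by move=> i j k; ring.
- by move=> i j k; ring.
Qed.

(** [X0], [X1], [Y2], [Y3] is the basis dual to u, w, e2, e3. The four cubic monomials in the X's
    prescribe the restriction, and [Y2] or [Y3] times the three quadratic ones prescribe the two
    quadrics. *)
Lemma restr_jac_surj A (g : 'rV[S]_4) (x y : S * S * S) : exists c : M -> S,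
  [/\ restr c A = g, normal_quadric (e2 S) c A = x & normal_quadric (e3 S) c A = y].
Proof.
pose X0 (i : 'I_4) : S := nth 0 [:: 1; 0; 0; 0] i.
pose X1 (i : 'I_4) : S := nth 0 [:: 0; 1; 0; 0] i.
pose Y2 (i : 'I_4) : S := nth 0 [:: - A 0 0; - A 0 1; 1; 0] i.
pose Y3 (i : 'I_4) : S := nth 0 [:: - A 0 o2; - A 0 o3; 0; 1] i.
have linE l v : lin l v = l 0 * v 0 + l 1 * v 1 + l o2 * v o2 + l o3 * v o3.
  rewrite /lin !big_ord_recl big_ord0 addr0 !addrA.
  by congr (_ + _ * _ + _ * _ + _ * _); congr (_ _); exact: val_inj.
pose add k c c' := fun m : M => k * c m + c' m : S.
exists (add (g 0 0) (prod3 X0 X0 X0) (add (g 0 1) (prod3 X0 X0 X1)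
  (add (g 0 o2) (prod3 X0 X1 X1) (add (g 0 o3) (prod3 X1 X1 X1)
  (add x.1.1 (prod3 Y2 X0 X0) (add x.1.2 (prod3 Y2 X0 X1) (add x.2 (prod3 Y2 X1 X1)
  (add y.1.1 (prod3 Y3 X0 X0) (add y.1.2 (prod3 Y3 X0 X1)
  (add y.2 (prod3 Y3 X1 X1) (fun=> 0))))))))))).
have tri0 u v w : tri (fun=> 0) u v w = 0 :> S.
  by rewrite /tri big1// => m _; rewrite mul0r.
have pair3 (a b c : S) (t : S * S * S) : a = t.1.1 -> b = t.1.2 -> c = t.2 -> (a, b, c) = t.
  by case: t => -[? ?] ? /= -> -> ->.
have X0u : lin X0 (uvec A) = 1 by rewrite linE /X0 /uvec /=; ring.
have X0w : lin X0 (wvec A) = 0 by rewrite linE /X0 /wvec /=; ring.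
have X1u : lin X1 (uvec A) = 0 by rewrite linE /X1 /uvec /=; ring.
have X1w : lin X1 (wvec A) = 1 by rewrite linE /X1 /wvec /=; ring.
have Y2u : lin Y2 (uvec A) = 0 by rewrite linE /Y2 /uvec /=; ring.
have Y2w : lin Y2 (wvec A) = 0 by rewrite linE /Y2 /wvec /=; ring.
have Y3u : lin Y3 (uvec A) = 0 by rewrite linE /Y3 /uvec /=; ring.
have Y3w : lin Y3 (wvec A) = 0 by rewrite linE /Y3 /wvec /=; ring.
have X02 : lin X0 (e2 S) = 0 by rewrite linE /X0 /e2 /=; ring.
have X12 : lin X1 (e2 S) = 0 by rewrite linE /X1 /e2 /=; ring.
have Y22 : lin Y2 (e2 S) = 1 by rewrite linE /Y2 /e2 /=; ring.
have Y32 : lin Y3 (e2 S) = 0 by rewrite linE /Y3 /e2 /=; ring.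
have X03 : lin X0 (e3 S) = 0 by rewrite linE /X0 /e3 /=; ring.
have X13 : lin X1 (e3 S) = 0 by rewrite linE /X1 /e3 /=; ring.
have Y23 : lin Y2 (e3 S) = 0 by rewrite linE /Y2 /e3 /=; ring.
have Y33 : lin Y3 (e3 S) = 1 by rewrite linE /Y3 /e3 /=; ring.
rewrite /add; split.
- apply/rowP => j; rewrite mxE; case: j => -[|[|[|[|//]]]] ? /=;
  rewrite !(cub_linl, dcub_linl) !(cub_prod3, dcub_prod3) /cub /dcub !tri0;
  rewrite !(X0u, X0w, X1u, X1w, Y2u, Y2w, Y3u, Y3w);
  rewrite !(mulr0, mul0r, mulr1, addr0, add0r); congr (g _ _); exact: val_inj.
- apply: pair3; rewrite !(pol_linl, dcub_linl) !(pol_prod3, dcub_prod3) /pol /dcub !tri0;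
  rewrite !(X0u, X0w, X1u, X1w, Y2u, Y2w, Y3u, Y3w, X02, X12, Y22, Y32); ring.
- apply: pair3; rewrite !(pol_linl, dcub_linl) !(pol_prod3, dcub_prod3) /pol /dcub !tri0;
  rewrite !(X0u, X0w, X1u, X1w, Y2u, Y2w, Y3u, Y3w, X03, X13, Y23, Y33); ring.
Qed.

End Product.

End CubicForm.

(** * Hensel's lemma and the number of zeros modulo p^n *)

Section PadicResidue.
Variables (p : nat) (p_pr : prime p).
Local Notation Zp := (padic_int p_pr).
Implicit Types x y : Zp.

(** The projection with its arguments in the order in which it can carry a ring morphism
    structure. *)
Definition red (n : nat) (x : Zp) : 'Z_(p ^ n.+1) := residue x n.

Lemma red_is_zmod_morphism n : zmod_morphism (red n).
Proof. by move=> x y. Qed.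

Lemma red_is_monoid_morphism n : monoid_morphism (red n).
Proof. by []. Qed.

HB.instance Definition _ n :=
  GRing.isZmodMorphism.Build Zp 'Z_(p ^ n.+1) (red n) (red_is_zmod_morphism n).
HB.instance Definition _ n :=
  GRing.isMonoidMorphism.Build Zp 'Z_(p ^ n.+1) (red n) (red_is_monoid_morphism n).

Lemma eq_natZp n (k l : nat) :
  (k%:R = l%:R :> 'Z_(p ^ n.+1)) <-> (k = l %[mod p ^ n.+1])%N.
Proof.
split=> [/(congr1 (@nat_of_ord _))|kl]; first by rewrite !val_Zp_nat ?(expn_gt1S p_pr).
by apply: val_inj; rewrite /= !val_Zp_nat ?(expn_gt1S p_pr).
Qed.

Lemma red_surj n (z : 'Z_(p ^ n.+1)) : exists x, red n x = z.
Proof. by exists (padic_nat p_pr z); rewrite /red /= natr_Zp. Qed.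

Lemma redW m n x y : (n <= m)%N -> red m x = red m y -> red n x = red n y.
Proof. by move=> nm xy; exact: padic_ballS nm x xy. Qed.

Lemma red_ext x y : (forall n, red n x = red n y) -> x = y.
Proof. exact: padic_ext. Qed.

Lemma redD_nat n k x : red n x = (residue x (n + k) : nat)%:R.
Proof. by rewrite -[LHS]natr_Zp; apply/eq_natZp; rewrite residue_modn. Qed.

(** Component m of the quotient is the residue of x of index m + n + 1, divided exactly by
    p^(n+1). *)
Lemma red_eq0P n x : red n x = 0 <-> exists y, x = p%:R ^+ n.+1 * y.
Proof.
split=> [x0|[y ->]]; last by rewrite rmorphM rmorphXn rmorph_nat pX_eq0// mul0r.
pose a m := (residue x (m + n.+1) %/ p ^ n.+1)%N.
have aK m : (a m * p ^ n.+1 = residue x (m + n.+1))%N.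
  apply: divnK; rewrite /dvdn.
  have := residue_modn x n m.+1; rewrite addnC addSnnS => ->.
  by rewrite -[residue x n]/(red n x) x0 mod0n.
have aP m : (((a m.+1)%:R%R : 'Z_(p ^ m.+2)) : nat) =
    ((a m)%:R%R : 'Z_(p ^ m.+1)) %[mod p ^ m.+1].
  rewrite !val_Zp_nat ?(expn_gt1S p_pr)// modn_mod modn_dvdm ?dvdn_expSS//.
  have : (a m.+1 * p ^ n.+1 = a m * p ^ n.+1 %[mod p ^ (m.+1 + n.+1)])%N.
    by rewrite !aK; exact: residue_compat.
  by rewrite expnD -!muln_modl => /eqP; rewrite eqn_pmul2r ?expn_gt0 ?prime_gt0// => /eqP.
exists (@PadicInt p p_pr (fun m => (a m)%:R) aP); apply: red_ext => m.
rewrite rmorphM rmorphXn rmorph_nat -natrX (redD_nat m n.+1 x).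
by rewrite /red /= -natrM -aK mulnC.
Qed.

Lemma red_unit x : red 0 x != 0 -> x \is a GRing.unit.
Proof.
move=> x0; have xU n : red n x \is a GRing.unit.
  rewrite pdvd_unit//; have := @residue_ndvd p p_pr x 0 n x0.
  by rewrite add0n.
have yP n : ((red n.+1 x)^-1 : nat) = ((red n x)^-1 : nat) %[mod p ^ n.+1].
  apply/eq_natZp; rewrite natr_Zp; apply: (mulIr (xU n)); rewrite (mulVr (xU n)).
  rewrite (redD_nat n 1 x) addn1 -natrM -[1]/(1%:R); apply/eq_natZp.
  rewrite -[RHS](modn_dvdm _ (dvdn_expSS p n)) -[LHS](modn_dvdm _ (dvdn_expSS p n)).
  congr (_ %% _)%N; apply/eq_natZp; rewrite natrM !natr_Zp.
  exact: mulVr (xU n.+1).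
apply/asboolP; exists (@PadicInt p p_pr (fun n => (red n x)^-1) yP).
by apply: red_ext => n; rewrite rmorphM rmorph1 -[X in X * _]/((red n x)^-1) (mulVr (xU n)).
Qed.

(** Completeness of Z_p; the limit is read off the diagonal. *)
Lemma red_lim (f : nat -> Zp) : (forall i, red i (f i.+1) = red i (f i)) ->
  exists x, forall i, red i x = red i (f i).
Proof.
move=> f_eq; have fP n : (residue (f n.+1) n.+1 : nat) = residue (f n) n %[mod p ^ n.+1].
  by rewrite residue_compat -[residue (f n.+1) n]/(red n (f n.+1)) f_eq.
by exists (@PadicInt p p_pr (fun n => residue (f n) n) fP).
Qed.

Lemma pdvd_redP n k x : (k <= n.+1)%N ->
  reflect (exists y, x = p%:R ^+ k * y) (pdvd k (red n x)).
Proof.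
move=> kn; apply: (iffP (pdvdP p_pr _ kn)) => [[z]|[y ->]]; last first.
  by exists (red n y); rewrite rmorphM rmorphXn rmorph_nat.
have [y <-] := red_surj z => xy.
have /red_eq0P[w xw] : red n (x - p%:R ^+ k * y) = 0.
  by rewrite rmorphB rmorphM rmorphXn rmorph_nat /= xy subrr.
exists (y + p%:R ^+ (n.+1 - k) * w).
by rewrite mulrDr mulrA -exprD subnKC// -xw addrC subrK.
Qed.

Lemma padic_eq0 x : (forall n, exists y, x = p%:R ^+ n * y) -> x = 0.
Proof.
by move=> xP; apply: red_ext => n; rewrite rmorph0; apply/red_eq0P; exact: xP.
Qed.

Lemma natp_neq0 (k : nat) : k != 0%N -> (k%:R : Zp) != 0.
Proof.
rewrite -lt0n => k0; apply/eqP => /(congr1 (red k)); rewrite rmorph_nat rmorph0.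
move=> /(eq_natZp _ _ 0); rewrite mod0n modn_small; first by case: k k0.
by apply: ltn_trans (ltn_expl _ (prime_gt1 p_pr)) _; rewrite ltn_exp2l// prime_gt1.
Qed.

Lemma pX_neq0 k : (p%:R ^+ k : Zp) != 0.
Proof. by rewrite -natrX natp_neq0// -lt0n expn_gt0 prime_gt0. Qed.

Definition exactv k x := exists2 u, u \is a GRing.unit & x = p%:R ^+ k * u.

Definition pexact n k (z : 'Z_(p ^ n.+1)) := pdvd k z && ~~ pdvd k.+1 z.

Lemma exactvP n k x : (k <= n)%N -> reflect (exactv k x) (pexact k (red n x)).
Proof.
move=> kn; apply: (iffP andP) => [[/(pdvd_redP _ (leqW kn))[u xu] nk]|[u uU ->]].
  exists u => //; apply: red_unit; apply: contra nk => /eqP/red_eq0P[y uy].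
  by apply/pdvd_redP => //; exists y; rewrite xu uy mulrA -exprD addn1.
rewrite /pexact rmorphM rmorphXn rmorph_nat !pdvd_pM ?(leqW kn)// subnn pdvdT subSnn.
by rewrite -pdvd_unit// rmorph_unit.
Qed.

Lemma exactv_ex x : x != 0 -> exists k, exactv k x.
Proof.
move=> x0; have nex : exists k, ~~ pdvd k (red k x).
  have [n xn] := padic_neq0 x0; exists n.+1.
  apply: contra xn => /(pdvd_redP _ (leqnSn _))[y xy].
  by apply/eqP/red_eq0P; exists y.
have [[|k] nk kmin] := ex_minnP nex; first by rewrite pdvdT in nk.
exists k; apply/(exactvP _ (leqnSn k)); rewrite /pexact nk andbT.
have : pdvd k (red k x) by apply/negPn/negP => /kmin; rewrite ltnn.
by move=> /(pdvd_redP _ (leqnSn _)) h; apply/pdvd_redP => //; rewrite ltnW.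
Qed.

End PadicResidue.

(** * Newton's method for the restriction of a cubic *)

Section Newton.
Variables (p : nat) (p_pr : prime p).
Local Notation Zp := (padic_int p_pr).
Variables (M : finType) (i1 i2 i3 : M -> 'I_4) (c : M -> Zp).
Implicit Types A h g : 'rV[Zp]_4.
Local Notation F := (restr i1 i2 i3 c).
Local Notation J := (jac i1 i2 i3 c).
Local Notation P k := (p%:R ^+ k : Zp).
Local Notation redm n := (map_mx (@red p p_pr n)).

Lemma redm_addX n k A h : (n < k)%N -> redm n (A + P k *: h) = redm n A.
Proof.
move=> nk; apply/rowP => j; rewrite !mxE rmorphD rmorphM /=.
suff -> : red n (P k) = 0 by rewrite mul0r addr0.
by apply/red_eq0P; exists (P (k - n.+1)); rewrite -exprD subnKC.
Qed.

Lemma redm_eqP n A A' : redm n A = redm n A' -> exists h, A = A' + P n.+1 *: h.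
Proof.
move=> AA'; have /all_sig[h hE] j : {y | A 0 j - A' 0 j = P n.+1 * y}.
  apply/cid/red_eq0P; rewrite rmorphB /=.
  by have := congr1 (fun B : 'rV_4 => B 0 j) AA'; rewrite !mxE => ->; rewrite subrr.
exists (\row_j h j); apply/rowP => j; rewrite !mxE -hE.
by rewrite addrC subrK.
Qed.

Lemma redm_surj n (B : 'rV['Z_(p ^ n.+1)]_4) : exists A, redm n A = B.
Proof.
have /all_sig[f fE] j : {x | @red p p_pr n x = B 0 j} by apply/cid/red_surj.
by exists (\row_j f j); apply/rowP => j; rewrite !mxE fE.
Qed.

Lemma red_det_jac n A : red n (\det (J A)) =
  \det (jac i1 i2 i3 (@red p p_pr n \o c) (redm n A)).
Proof. by rewrite rmorph_jac det_map_mx. Qed.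

Lemma exact_det_congr k A A' : redm k A = redm k A' ->
  exactv k (\det (J A)) -> exactv k (\det (J A')).
Proof.
move=> AA' /(exactvP _ (leqnn k)) h; apply/(exactvP _ (leqnn k)).
have E : red k (\det (J A')) = red k (\det (J A)).
  apply: etrans (red_det_jac k A') (etrans _ (esym (red_det_jac k A))).
  by rewrite AA'.
by rewrite E.
Qed.

(** By the adjugate formula, h J = - p^k g, so the linear term at p^(m-k) h cancels p^m g. The
    remainder is divisible by p^(2(m-k)), hence by p^(m+1) because 2 k < m. *)
Lemma newton_step k m A g : (2 * k < m)%N -> F A = P m *: g ->
  exactv k (\det (J A)) -> exists h g', F (A + P (m - k) *: h) = P m.+1 *: g'.
Proof.
move=> km FA [w wU detJ]; pose h := - w^-1 *: (g *m \adj (J A)).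
have hJ : h *m J A = - P k *: g.
  rewrite -scalemxAl -mulmxA mul_adj_mx mul_mx_scalar detJ scalerA.
  by congr (_ *: _); rewrite mulNr mulrCA mulVr// mulr1.
have [G FE] := restr_taylor i1 i2 i3 c A h (P (m - k)).
exists h, (P (2 * (m - k) - m.+1) *: G).
rewrite FE FA hJ !scalerA mulrN -!exprD subnK; last by lia.
by rewrite scaleNr subrr add0r -exprM; congr (P _ *: _); lia.
Qed.

Lemma newton k m A g : (2 * k < m)%N -> F A = P m *: g ->
  exactv k (\det (J A)) ->
  exists A', [/\ F A' = 0, exactv k (\det (J A')) &
    redm (m - k).-1 A' = redm (m - k).-1 A].
Proof.
move=> km FA0 eA0.
pose ok i A := (exists g, F A = P (m + i) *: g) /\ exactv k (\det (J A)).
have step i A1 : ok i A1 ->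
    {A2 | ok i.+1 A2 /\ redm (m + i - k).-1 A2 = redm (m + i - k).-1 A1}.
  move=> okA1; apply: cid; case: okA1 => [[g1 FA1] eA1].
  have [|h [g' FA2]] := newton_step (m := m + i) _ FA1 eA1; first by lia.
  have rA : redm (m + i - k).-1 (A1 + P (m + i - k) *: h) = redm (m + i - k).-1 A1.
    by apply: redm_addX; lia.
  exists (A1 + P (m + i - k) *: h); split; last exact: rA; split.
    by exists g'; rewrite FA2 addnS.
  apply: exact_det_congr eA1; apply/esym/redm_addX; lia.
have ok0 : ok 0%N A by split=> //; exists g; rewrite addn0.
(* Each iterate carries its invariant [ok], without which the next step cannot be chosen. *)
pose seqA := fix s i : {A1 | ok i A1} := match i with
  | 0%N => exist _ A ok0
  | i'.+1 => let: exist A1 okA1 := s i' in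
             let: exist A2 hA2 := step i' A1 okA1 in exist _ A2 (proj1 hA2)
  end.
pose a i := sval (seqA i).
have aok i : ok i (a i) by rewrite /a; case: (seqA i).
have aS i : redm (m + i - k).-1 (a i.+1) = redm (m + i - k).-1 (a i).
  by rewrite /a /=; case: (seqA i) => A1 okA1 /=; case: (step _ _ _) => A2 [].
have redmW n n' (B B' : 'rV[Zp]_4) : (n <= n')%N -> redm n' B = redm n' B' -> redm n B = redm n B'.
  move=> nn' BB'; apply/rowP => j; rewrite !mxE; apply: redW nn' _.
  by have := congr1 (fun B : 'rV_4 => B 0 j) BB'; rewrite !mxE.
have aS' i : redm i (a i.+1) = redm i (a i) by apply: redmW (aS i); lia.
have lim_ex (j : 'I_4) : exists x : Zp, forall i, red i x = red i (a i 0 j).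
  apply: (red_lim (f := fun i => a i 0 j)) => i.
  by have := congr1 (fun B : 'rV_4 => B 0 j) (aS' i); rewrite !mxE.
have [l lE] := boolp.choice lim_ex.
pose A' : 'rV[Zp]_4 := \row_j l j.
have A'E i : redm i A' = redm i (a i) by apply/rowP => j; rewrite !mxE lE.
have a0 i : redm (m - k).-1 (a i) = redm (m - k).-1 A.
  elim: i => [//|i <-]; apply: redmW (aS i); lia.
exists A'; split.
- apply/rowP => j; apply: red_ext => i.
  have E B : red i (F B 0 j) = restr i1 i2 i3 (@red p p_pr i \o c) (redm i B) 0 j.
    by rewrite rmorph_restr [RHS]mxE.
  rewrite E A'E -E; have [[g1 ->] _] := aok i.
  rewrite [X in _ = red i X]mxE rmorph0 [X in red i X]mxE; apply/red_eq0P.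
  exists (P (m + i - i.+1) * g1 0 j); rewrite mulrA -exprD; congr (P _ * _); lia.
- apply: (exact_det_congr (A := A)) => //; apply: (@redmW _ (m - k).-1); first lia.
  by rewrite A'E a0.
- by rewrite A'E a0.
Qed.

(** If A' = A + p^e h with e > k, the expansion gives h J = - p^e G. Multiplying by the adjugate
    shows that p^(e-k) divides h, so A' and A agree to higher order, and by induction to all
    orders. *)
Lemma zero_isolated k A A' : F A = 0 -> F A' = 0 -> exactv k (\det (J A)) ->
  redm k A' = redm k A -> A' = A.
Proof.
move=> FA FA' [w wU detJ] AA'.
have step e h : (k < e)%N -> A' = A + P e *: h -> exists h', A' = A + P e.+1 *: h'.
  move=> ke A'E; have [G] := restr_taylor i1 i2 i3 c A h (P e).
  rewrite -A'E FA FA' add0r => /esym/eqP; rewrite addr_eq0 expr2 -scalerA -scalerN.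
  have scI (B B' : 'rV[Zp]_4) : P e *: B = P e *: B' -> B = B'.
    move=> BB'; apply/rowP => j; have := congr1 (fun B : 'rV_4 => B 0 j) BB'.
    by rewrite !mxE => /(mulfI (pX_neq0 p_pr e)).
  move=> /eqP/scI hJ.
  have : (h *m J A) *m \adj (J A) = - (P e *: G) *m \adj (J A) by rewrite hJ.
  rewrite -mulmxA mul_mx_adj mul_mx_scalar detJ => hE.
  pose h' := P (e - k.+1) *: (- w^-1 *: (G *m \adj (J A))).
  exists h'; rewrite A'E; congr (_ + _); apply/rowP => j.
  have hj : P k * w * h 0 j = - (P e * (G *m \adj (J A)) 0 j).
    have := congr1 (fun B : 'rV_4 => B 0 j) hE.
    by rewrite mulNmx -scalemxAl [LHS]mxE [RHS]mxE [X in - X]mxE.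
  have Pe : P k * (P e.+1 * P (e - k.+1)) = P e * P e.
    by rewrite -!exprD; congr (P _); lia.
  rewrite [LHS]mxE [RHS]mxE [X in _ = _ * X]mxE [X in _ = _ * (_ * X)]mxE.
  apply: (mulfI (pX_neq0 p_pr k)); move: hj; set N := (G *m _) 0 j => hj.
  transitivity (P e * (w^-1 * (P k * w * h 0 j))).
    rewrite mulrCA -[P k * h 0 j](mulKr wU); congr (_ * (_ * _)).
    by rewrite mulrCA mulrA.
  transitivity (P k * (P e.+1 * P (e - k.+1)) * (- w^-1 * N)); last by ring.
  by rewrite hj Pe; ring.
have : forall e, exists h, A' = A + P (k.+1 + e) *: h.
  elim=> [|e [h hE]]; first by rewrite addn0; exact: redm_eqP.
  rewrite addnS; apply: step hE; lia.
move=> A'E; apply/rowP => j; apply/eqP; rewrite -subr_eq0; apply/eqP.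
apply: padic_eq0 => n; have [h ->] := A'E n.
exists (P k.+1 * h 0 j); rewrite !mxE addrAC subrr add0r mulrA -exprD; congr (P _ * _); lia.
Qed.

End Newton.

Lemma card_rV_forall (T : finType) m (P : 'I_m -> pred T) :
  #|[pred B : 'rV[T]_m | [forall i, P i (B 0 i)]]| = (\prod_i #|P i|)%N.
Proof.
have := card_family P; rewrite foldrE big_map big_enum => <-.
pose f (B : 'rV[T]_m) : {ffun 'I_m -> T} := [ffun i => B 0 i].
have finj : injective f.
  by move=> B B' /ffunP h; apply/rowP => i; have := h i; rewrite !ffunE.
rewrite -(card_imset _ finj); apply: eq_card => g; apply/imsetP/familyP => [[B + ->] i|gP].
  by rewrite ffunE => /forallP/(_ i).
exists (\row_i g i); last by apply/ffunP => i; rewrite !ffunE mxE.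
by apply/forallP => i; rewrite mxE; exact: gP.
Qed.

Section KernelCount.
Variables (p : nat) (p_pr : prime p) (n : nat).
Local Notation R := 'Z_(p ^ n.+1).

Lemma Zp_factor (x : R) : x != 0 ->
  exists j, exists u, [/\ (j <= n)%N, u \is a GRing.unit & x = p%:R ^+ j * u].
Proof.
have [X <-] := red_surj p_pr x => X0.
have /exactv_ex[j [u uU XE]] : X != 0.
  by apply: contraNneq X0 => ->; rewrite rmorph0.
exists j, (red n u); split.
- rewrite leqNgt; apply: contraNN X0 => nj; apply/eqP/red_eq0P.
  by exists (p%:R ^+ (j - n.+1) * u); rewrite mulrA -exprD subnKC.
- exact: rmorph_unit.
- by rewrite XE rmorphM rmorphXn rmorph_nat.
Qed.

Lemma card_annihilator j u : (j <= n)%N -> u \is a GRing.unit ->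
  #|[pred x : R | x * (p%:R ^+ j * u) == 0]| = (p ^ j)%N.
Proof.
move=> jn uU.
have aux (a : nat) : (a * p ^ (n.+1 - j) = p ^ n.+1 -> a = p ^ j)%N.
  rewrite -{2}(subnKC (leqW jn)) expnD => /eqP.
  by rewrite eqn_pmul2r ?expn_gt0 ?prime_gt0// => /eqP.
rewrite -(aux _ (card_pdvd p_pr (leq_subr j n.+1))); apply: eq_card => x.
rewrite !inE mulrA mulrC mulrI_eq0; last exact: mulrI uU.
by rewrite mulrC pX_mul_eq0// leqW.
Qed.

(* The Smith normal form of an integral lift of B reduces this to diagonal B. *)
Lemma card_ker m k (B : 'M[R]_m) : (k <= n)%N -> pexact k (\det B) ->
  #|[pred v : 'rV[R]_m | v *m B == 0]| = (p ^ k)%N.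
Proof.
move=> kn Bk.
pose f := intmul (1 : R) : int -> R.
pose Bi : 'M[int]_m := map_mx (fun x : R => (x : nat)%:Z) B.
have BE : B = map_mx intr Bi.
  by apply/matrixP => i j; rewrite !mxE -[RHS]/((B i j : nat)%:R) natr_Zp.
have [L Lu [U Uu [d _ BiE]]] := int_Smith_normal_form Bi.
pose e i : R := (d`_i)%:~R.
pose L' : 'M[R]_m := map_mx intr L; pose U' : 'M[R]_m := map_mx intr U.
have L'u : L' \in unitmx by rewrite unitmxE det_map_mx rmorph_unit// -unitmxE.
have U'u : U' \in unitmx by rewrite unitmxE det_map_mx rmorph_unit// -unitmxE.
have {}BE : B = L' *m diag_mx (\row_i e i) *m U'.
  rewrite BE BiE !map_mxM; congr (_ *m _ *m _).
  by apply/matrixP => i j; rewrite !mxE rmorphMn.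
have detB : \det B = \det L' * (\prod_(i < m) e i) * \det U'.
  rewrite BE !det_mulmx det_diag; congr (_ * _ * _).
  by apply: eq_bigr => i _; rewrite mxE.
have e0 i : (i < m)%N -> e i != 0.
  move=> im; apply: contraTneq Bk => ei0; rewrite detB (bigD1 (Ordinal im))//= ei0.
  by rewrite mul0r mulr0 mul0r /pexact !pdvd0.
have [j jP] := boolp.choice (fun i : 'I_m => Zp_factor (e0 i (ltn_ord i))).
have [u uP] := boolp.choice jP.
(* The kernel of the diagonal matrix has order p to the sum of the valuations of the entries, and
   this sum is the valuation of det B. *)
have sumj : (\sum_i j i)%N = k.
  have prodE : \prod_(i < m) e i = p%:R ^+ (\sum_i j i)%N * \prod_i u i.
    rewrite -prodrXr -big_split; apply: eq_bigr => i _.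
    by have [_ _ ->] := uP i.
  have uU : \prod_i u i \is a GRing.unit.
    by apply: rpred_prod => i _; have [_ + _] := uP i.
  move: Bk; rewrite detB prodE; set s := (\sum_i j i)%N; set w := \prod_i u i.
  have -> : \det L' * (p%:R ^+ s * w) * \det U' = p%:R ^+ s * (\det L' * \det U' * w).
    by rewrite mulrCA -!mulrA; congr (_ * (_ * _)); rewrite mulrC.
  rewrite /pexact !pdvd_pM ?(leqW kn)//.
  have : ~~ pdvd 1 (\det L' * \det U' * w).
    by rewrite -pdvd_unit// !unitrM -!unitmxE L'u U'u.
  move: (\det L' * _ * w) => z z1 /andP[h1 h2].
  apply/eqP; rewrite eqn_leq; apply/andP; split.
    rewrite leqNgt; apply: contra h2; rewrite -subn_eq0 => /eqP ->; exact: pdvdT.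
  rewrite leqNgt; apply: contra z1; rewrite -subn_gt0 => h; exact: pdvdW h h1.
have Linj : injective (fun v : 'rV[R]_m => v *m L').
  exact: can_inj (mulmxK L'u).
transitivity (#|[pred v : 'rV[R]_m | [forall i, v 0 i * e i == 0%R]]|).
  rewrite -(card_imset _ Linj); apply: eq_card => v; apply/imsetP/forallP => [[v' + ->] i|vP].
    rewrite inE BE !mulmxA => /eqP/(congr1 (fun z => z *m invmx U')).
    rewrite mulmxK// mul0mx => /rowP/(_ i); rewrite mul_mx_diag mxE mxE [RHS]mxE mxE => h.
    by apply/eqP.
  exists (v *m invmx L'); last exact: esym (mulmxKV L'u v).
  rewrite inE BE !mulmxA (mulmxKV L'u v); apply/eqP; rewrite (_ : v *m _ = 0) ?mul0mx//.
  apply/rowP => i; rewrite mul_mx_diag !mxE; exact/eqP/vP.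
rewrite (card_rV_forall (fun i => [pred x | x * e i == 0])) -sumj expn_sum.
by apply: eq_bigr => i _; have [ji ui ->] := uP i; exact: card_annihilator.
Qed.

End KernelCount.

Section ZeroCount.
Variables (p : nat) (p_pr : prime p).
Local Notation Zp := (padic_int p_pr).
Variables (M : finType) (i1 i2 i3 : M -> 'I_4) (msk : pred 'I_4).

(* The coordinates selected by msk are required to be divisible by p. *)
Definition mask_mod n (B : 'rV['Z_(p ^ n.+1)]_4) :=
  [forall e, msk e ==> pdvd 1 (B 0 e)].

Definition approx_zeros n k (cb : M -> 'Z_(p ^ n.+1)) :=
  [pred B : 'rV_4 | [&& restr i1 i2 i3 cb B == 0,
    pexact k (\det (jac i1 i2 i3 cb B)) & mask_mod B]].

Definition chart_zeros (c : M -> Zp) : set 'rV[Zp]_4 :=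
  [set A | restr i1 i2 i3 c A = 0 /\ forall e, msk e -> red 0 (A 0 e) = 0].

Definition exact_zeros k (c : M -> Zp) : set 'rV[Zp]_4 :=
  [set A | chart_zeros c A /\ exactv k (\det (jac i1 i2 i3 c A))].

Variables (n k : nat) (kn : (2 * k <= n)%N) (c : M -> Zp).
Local Notation F := (restr i1 i2 i3 c).
Local Notation J := (jac i1 i2 i3 c).
Local Notation R := 'Z_(p ^ n.+1).
Local Notation cb := (@red p p_pr n \o c).
Local Notation Fb := (restr i1 i2 i3 cb).
Local Notation Jb := (jac i1 i2 i3 cb).
Local Notation redm := (map_mx (@red p p_pr n)).
Local Notation t := (p%:R ^+ (n - k).+1 : Zp).

Let kn' : (k <= n)%N. Proof. by move: kn; lia. Qed.

(** Here 2 k <= n makes t^2 = p^(2(n-k+1)) vanish modulo p^(n+1), so that F is affine along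
    multiples of t. *)
Let redm_tt (G : 'rV[Zp]_4) : redm (t ^+ 2 *: G) = 0.
Proof.
apply/rowP => j; rewrite [LHS]mxE [RHS]mxE [X in red n X]mxE; apply/red_eq0P.
exists (p%:R ^+ ((n - k).+1 * 2 - n.+1) * G 0 j).
rewrite mulrA -exprD -exprM; congr (p%:R ^+ _ * _); move: kn; lia.
Qed.

Let mask_red n' (A : 'rV[Zp]_4) : mask_mod (map_mx (@red p p_pr n') A) <->
  forall e, msk e -> red 0 (A 0 e) = 0.
Proof.
split=> [/forallP h e me|h].
  have := h e; rewrite me mxE /= => /(pdvd_redP _ (isT : (1 <= n'.+1)%N))[y ->].
  by apply/red_eq0P; exists y.
apply/forallP => e; apply/implyP => /h /red_eq0P[y yE].
by rewrite mxE; apply/pdvd_redP => //; exists y.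
Qed.

Let redm_step (A h : 'rV[Zp]_4) : F A = 0 ->
  Fb (redm (A + t *: h)) = redm (t *: h) *m Jb (redm A).
Proof.
move=> FA; have [G FE] := restr_taylor i1 i2 i3 c A h t.
rewrite rmorph_restr FE FA add0r map_mxD redm_tt addr0 rmorph_jac -map_mxM.
by rewrite scalemxAl.
Qed.

(** Multiplying v J = 0 by the adjugate gives p^k v = 0 up to a unit, so v is a multiple of
    p^(n-k+1). *)
Let ker_lift (A : 'rV[Zp]_4) (v : 'rV[R]_4) : exact_zeros k c A ->
  v *m Jb (redm A) = 0 -> exists h, v = redm (t *: h).
Proof.
move=> [_ [w wU detJ]] vJ.
have := congr1 (mulmx^~ (\adj (Jb (redm A)))) vJ.
rewrite mul0mx -mulmxA mul_mx_adj mul_mx_scalar rmorph_jac det_map_mx detJ => h.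
have vP j : pdvd (n - k).+1 (v 0 j).
  rewrite -subSn// -pX_mul_eq0 ?leqW//; apply/eqP.
  have /rowP/(_ j) := h; rewrite [LHS]mxE [RHS]mxE rmorphM rmorphXn rmorph_nat.
  rewrite mulrAC mulrC => /(congr1 (fun z => (red n w)^-1 * z)).
  by rewrite mulKr ?mulr0// rmorph_unit.
have nk : ((n - k).+1 <= n.+1)%N by rewrite ltnS leq_subr.
have [z zE] := boolp.choice (fun j => elimT (pdvdP p_pr (v 0 j) nk) (vP j)).
have [g gE] := redm_surj p_pr (\row_j z j).
exists g; apply/rowP => j; rewrite zE [RHS]mxE [X in red n X]mxE rmorphM rmorphXn rmorph_nat.
by have /rowP/(_ j) := gE; rewrite [LHS]mxE [RHS]mxE => <-.
Qed.

Let Zs := [pred B : 'rV[R]_4 | `[< exists2 A, exact_zeros k c A & redm A = B >]].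

Let approx_of_zero (B v : 'rV[R]_4) : B \in Zs -> v *m Jb B = 0 ->
  B + v \in approx_zeros k cb.
Proof.
move=> /asboolP[A AZ <-] vJ; have [h vE] := ker_lift AZ vJ.
have [[FA mA] eA] := AZ.
rewrite vE -map_mxD inE; apply/and3P; split.
- by rewrite redm_step// -vE vJ.
- rewrite -red_det_jac; apply/(exactvP _ kn'); apply: exact_det_congr eA.
  by apply/esym/redm_addX; move: kn; lia.
- apply/mask_red => e /mA <-.
  have /rowP/(_ e) := redm_addX A h (ltn0Sn (n - k)).
  by rewrite [LHS]mxE [RHS]mxE.
Qed.

Let zero_of_approx (B : 'rV[R]_4) : B \in approx_zeros k cb ->
  exists2 u, (u.1 \in Zs) && (u.2 *m Jb u.1 == 0) & B = u.1 + u.2.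
Proof.
have [A <-] := redm_surj p_pr B; rewrite inE => /and3P[/eqP FA eA mA].
have [g FAE] : exists g, F A = p%:R ^+ n.+1 *: g.
  have /redm_eqP[g ->] : redm (F A) = redm 0.
    by rewrite -rmorph_restr FA; apply/rowP => j; rewrite !mxE rmorph0.
  by exists g; rewrite add0r.
have {}eA : exactv k (\det (J A)) by apply/(exactvP _ kn'); rewrite red_det_jac.
have [A' [FA' eA' AA']] := newton (kn : (2 * k < n.+1)%N) FAE eA.
have {}AA' : map_mx (@red p p_pr (n - k)) A = map_mx (@red p p_pr (n - k)) A'.
  by move: AA'; rewrite subSn.
have [h AE] := redm_eqP AA'.
exists (redm A', redm (t *: h)) => /=; last by rewrite AE map_mxD.
apply/andP; split; last by rewrite -redm_step// -AE FA.
apply/asboolP; exists A' => //; split=> //; split=> // e me.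
have /(_ e me) <- := (mask_red n A).1 mA.
have /rowP/(_ e) := redm_addX A' h (ltn0Sn (n - k)); rewrite -AE.
by rewrite [LHS]mxE [RHS]mxE.
Qed.

(** Distinct zeros are already separated modulo p^(k+1), and p^(k+1) divides t because 2 k <= n. *)
Let zero_inj (A A' h h' : 'rV[Zp]_4) : exact_zeros k c A -> exact_zeros k c A' ->
  redm (A + t *: h) = redm (A' + t *: h') -> A = A'.
Proof.
move=> [[FA _] _] [[FA' _] eA'] AA'; apply: zero_isolated FA' FA eA' _.
rewrite -(redm_addX A h (k := (n - k).+1)); last by move: kn; lia.
rewrite -(redm_addX A' h' (k := (n - k).+1)); last by move: kn; lia.
apply/rowP => j; rewrite [LHS]mxE [RHS]mxE; apply: (redW kn').
by have /rowP/(_ j) := AA'; rewrite [LHS]mxE [RHS]mxE.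
Qed.

(* The approximate zeros are the sums of the class of a zero and of an element of
   the kernel of the Jacobian matrix at this zero, in a unique way. *)
Let card_approx : #|approx_zeros k cb| = (#|Zs| * p ^ k)%N.
Proof.
pose T := [pred u : 'rV[R]_4 * 'rV[R]_4 | (u.1 \in Zs) && (u.2 *m Jb u.1 == 0)].
transitivity #|T|.
  have addT_inj : {in T &, injective (fun u : 'rV[R]_4 * 'rV[R]_4 => u.1 + u.2)}.
    move=> [B v] [B' v'] /andP[/= BZ /eqP vJ] /andP[/= BZ' /eqP vJ'].
    case/asboolP: BZ vJ => A AZ <- vJ; case/asboolP: BZ' vJ' => A' AZ' <- vJ'.
    have [h vE] := ker_lift AZ vJ; have [h' vE'] := ker_lift AZ' vJ'.
    rewrite vE vE' => hh'; have AA' : A = A'.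
      by apply: (zero_inj (h := h) (h' := h')) => //; rewrite !map_mxD.
    by move: hh'; rewrite AA' => /addrI ->.
  rewrite -(card_in_imset addT_inj); apply: eq_card => B.
  apply/idP/imsetP => [/zero_of_approx[u uT ->]|[u /andP[uZ /eqP uJ] ->]].
    by exists u.
  exact: approx_of_zero.
rewrite -sum1_card -sum_nat_const.
rewrite -(pair_big_dep (fun B => B \in Zs) (fun B v => v *m Jb B == 0)
  (fun _ _ => 1%N)) /=.
apply: eq_bigr => B /asboolP[A [_ eA] <-].
rewrite sum1_card -(card_ker (B := Jb (redm A)) p_pr kn')//.
by rewrite -red_det_jac; apply/(exactvP _ kn').
Qed.

(** The passage from p-adic zeros to finite data: the right-hand side depends only on the
    coefficients modulo p^(n+1). *)
Lemma counting_exact_zeros (K : realType) :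
  (counting (exact_zeros k c) = ((#|approx_zeros k cb|)%:R / p%:R ^+ k : K)%:E)%E.
Proof.
have lift_ex (B : 'rV[R]_4) : exists A, B \in Zs -> exact_zeros k c A /\ redm A = B.
  have [/asboolP[A AZ AB]|_] := boolP (B \in Zs); first by exists A.
  by exists 0.
have [l lP] := boolp.choice lift_ex.
pose s := [seq l B | B <- enum Zs].
have s_uniq : uniq s.
  rewrite map_inj_in_uniq ?enum_uniq// => B B'; rewrite !mem_enum => BZ BZ' ll.
  by have [_ <-] := lP _ BZ; have [_ <-] := lP _ BZ'; rewrite ll.
have sE : exact_zeros k c = [set` [fset x in s]%fset].
  apply/seteqP; split=> [A AZ|A].
    rewrite /= inE; apply/mapP; have BZ : redm A \in Zs by apply/asboolP; exists A.
    exists (redm A); first by rewrite mem_enum.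
    have [lZ lE] := lP _ BZ.
    by apply: (zero_inj (h := 0) (h' := 0)) => //; rewrite !scaler0 !addr0 lE.
  by rewrite /= inE => /mapP[B]; rewrite mem_enum => /lP[? _] ->.
rewrite /counting sE asboolT; last exact: finite_fset.
rewrite set_fsetK card_fseq undup_id// size_map -cardE card_approx natrM natrX.
by rewrite mulfK// expf_neq0// pnatr_eq0 -lt0n prime_gt0.
Qed.

End ZeroCount.

(** * The mean number of zeros modulo p^(n+1) *)

Section FiniteExpectation.
Variables (p : nat) (p_pr : prime p) (n : nat).
Local Notation R := 'Z_(p ^ n.+1).
Local Notation q := (p ^ n.+1)%N.
Local Notation V := (R * R * R)%type.
Variables (M : finType) (i1 i2 i3 : M -> 'I_4).
Variable mono : 'I_4 -> 'I_4 -> 'I_4 -> M.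
Hypothesis monoP : forall i j k, perm_eq
  [:: i1 (mono i j k); i2 (mono i j k); i3 (mono i j k)] [:: i; j; k].

(** The restriction and the two quadrics form an additive surjection of the coefficients onto a
    group of order q^10, with 10 = 4 + 3 + 3, so they are jointly uniform. *)
Lemma card_restr_jac (Q : pred R) (A : 'rV[R]_4) :
  (#|[pred c : {ffun M -> R} | (restr i1 i2 i3 c A == 0%R) &&
      Q (\det (jac i1 i2 i3 c A))]| * q ^ 10
   = #|[pred u : V * V | Q (bres u.1 u.2)]| * q ^ #|M|)%N.
Proof.
pose phi (c : {ffun M -> R}) : 'rV[R]_4 * (V * V) := (restr i1 i2 i3 c A,
  (normal_quadric i1 i2 i3 (e2 R) c A, normal_quadric i1 i2 i3 (e3 R) c A)).
have /boolp.choice[s sP] (v : 'rV[R]_4 * (V * V)) : exists c, phi c = v.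
  case: v => g [x y]; have [c [cg cx cy]] := restr_jac_surj monoP A g x y.
  exists (finfun c).
  rewrite /phi (_ : (finfun c : M -> R) = c) ?cg ?cx ?cy//.
  by apply/funext => m; rewrite ffunE.
have phiD c c' : phi (c + c') = phi c + phi c'.
  have cE : (c + c' : M -> R) = fun m => 1 * c m + c' m.
    by apply/funext => m; rewrite ffunE mul1r.
  rewrite /phi cE; congr (_, (_, _)).
  - apply/rowP => j; rewrite !mxE !(cub_linl, dcub_linl) !mul1r.
    by case: j => -[|[|[|[|//]]]].
  - by rewrite /normal_quadric !(dcub_linl, pol_linl) !mul1r.
  - by rewrite /normal_quadric !(dcub_linl, pol_linl) !mul1r.
pose S := [pred v : 'rV[R]_4 * (V * V) | (v.1 == 0) && Q (bres v.2.1 v.2.2)].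
have := card_equivariant (phi := phi) (tau := fun v c => c + s v) S.
rewrite !card_prod card_mx !card_R// card_ffun card_R//.
have -> : (q ^ (1 * 4) * (q * q * q * (q * q * q)) = q ^ 10)%N by ring.
have -> : #|[pred c | S (phi c)]| = #|[pred c : {ffun M -> R} |
    (restr i1 i2 i3 c A == 0%R) && Q (\det (jac i1 i2 i3 c A))]|.
  by apply: eq_card => c; rewrite !inE /= /jac det_sylv.
have -> : #|S| = #|[pred u : V * V | Q (bres u.1 u.2)]|.
  have := cardX (pred1 (0 : 'rV[R]_4)) [pred u : V * V | Q (bres u.1 u.2)].
  by rewrite card1 mul1n => <-; apply: eq_card => -[g [x y]]; rewrite !inE.
apply=> [v|v c]; first exact: addIr.
by rewrite phiD sP.
Qed.

Variable msk : pred 'I_4.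

Lemma card_mask_mod :
  (#|[pred B : 'rV[R]_4 | mask_mod msk B]| * p ^ #|msk| = q ^ 4)%N.
Proof.
rewrite (_ : #|_| = \prod_(e : 'I_4) #|[pred x : R | msk e ==> pdvd 1 x]|)%N; last first.
  by rewrite -card_rV_forall.
have -> : (p ^ #|msk| = \prod_(e : 'I_4) (if msk e then p else 1))%N.
  by rewrite -big_mkcond prod_nat_const.
transitivity (\prod_(e : 'I_4) q)%N; last by rewrite prod_nat_const card_ord.
rewrite -big_split; apply: eq_bigr => e _ /=; case: (msk e) => /=.
  apply: etrans (card_pdvd p_pr (n := n) (j := 1) isT); rewrite expn1.
  by congr (_ * _)%N; apply: eq_card.
by rewrite muln1; apply: etrans (card_R p_pr n); apply: eq_card.
Qed.

(** Exchange the sums: for fixed B the number of c is independent of B. [Q] will be the condition of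
    valuation k for the mean, and vanishing for the singular zeros. *)
Lemma sum_approx (K : realFieldType) (Q : pred R) :
  \sum_(c : {ffun M -> R}) (#|[pred B : 'rV[R]_4 | [&& restr i1 i2 i3 c B == 0%R,
    Q (\det (jac i1 i2 i3 c B)) & mask_mod msk B]]|)%:R
  = q%:R ^+ #|M| * p%:R^-1 ^+ #|msk| * #|[pred u : V * V | Q (bres u.1 u.2)]|%:R
    / q%:R ^+ 6 :> K.
Proof.
pose N := #|[pred u : V * V | Q (bres u.1 u.2)]|.
have h : ((\sum_(c : {ffun M -> R}) #|[pred B : 'rV[R]_4 | [&& restr i1 i2 i3 c B == 0%R,
    Q (\det (jac i1 i2 i3 c B)) & mask_mod msk B]]|) * q ^ 10 * p ^ #|msk|
    = N * q ^ #|M| * q ^ 4)%N.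
  under eq_bigr do rewrite -sum1_card big_mkcond /=.
  rewrite exchange_big /= (bigID (mask_mod msk (n := n))) /=.
  rewrite [X in (_ + X)%N]big1 ?addn0; last first.
    by move=> B /negbTE Bm; rewrite big1// => c _; rewrite inE Bm !andbF.
  rewrite big_distrl /= (eq_bigr (fun=> N * q ^ #|M|)%N); last first.
    move=> B Bm; rewrite -(card_restr_jac Q B); congr (_ * _)%N.
    rewrite -big_mkcond /= sum1_card; apply: eq_card => c.
    by rewrite unfold_in Bm andbT [RHS]unfold_in.
  by rewrite sum_nat_const mulnAC card_mask_mod mulnC.
have q0 : (q%:R : K) != 0 by rewrite pnatr_eq0 -lt0n expn_gt0 prime_gt0.
have p0 : (p%:R : K) != 0 by rewrite pnatr_eq0 -lt0n prime_gt0.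
move: h => /(congr1 (fun i => i%:R : K)).
rewrite -natr_sum [in LHS]natrM [in LHS]natrM [in RHS]natrM [in RHS]natrM.
rewrite ![(q ^ _)%:R]natrX [(p ^ #|msk|)%:R]natrX => h.
apply: (mulIf (expf_neq0 10 q0)); apply: (mulIf (expf_neq0 #|msk| p0)).
rewrite h exprVn; field.
by rewrite q0 expf_neq0.
Qed.

End FiniteExpectation.

Section ResultantLaw.
Variables (p : nat) (p_pr : prime p) (n : nat) (K : realFieldType).
Local Notation R := 'Z_(p ^ n.+1).
Local Notation q := (p ^ n.+1)%N.
Local Notation V := (R * R * R)%type.

Lemma card_pdvd_bres j : (j <= n.+1)%N ->
  #|[pred u : V * V | pdvd j (bres u.1 u.2)]|%:R = q%:R ^+ 6 * prob_res K p j.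
Proof.
move=> jn; rewrite -count_resE//; congr (_%:R).
rewrite /count_res pair_bigA -sum1_card big_mkcond; apply: eq_bigr => u _.
by rewrite inE; case: (pdvd _ _).
Qed.

Lemma card_pexact_bres k : (k <= n)%N ->
  #|[pred u : V * V | pexact k (bres u.1 u.2)]|%:R =
  q%:R ^+ 6 * (prob_res K p k - prob_res K p k.+1).
Proof.
move=> kn; rewrite mulrBr -!card_pdvd_bres ?(leqW kn)//; apply/eqP.
rewrite eq_sym subr_eq -natrD; apply/eqP; congr (_%:R).
rewrite -(cardID [pred u : V * V | pdvd k.+1 (bres u.1 u.2)]) addnC.
congr (_ + _)%N; apply: eq_card => u; rewrite !inE /pexact andbC//.
by case/boolP : (pdvd k.+1 _) => // /(pdvdW (leqnSn k)) ->.
Qed.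

End ResultantLaw.

(** * The charts of the space of lines *)

Section Monomials.
Import -(notations) mpoly.

Definition mono3 (i j k : 'I_4) : multinom 4 :=
  mnm_add (mnm1 i) (mnm_add (mnm1 j) (mnm1 k)).

Lemma mdeg_pos (m : multinom 4) k : mdeg m = k.+1 ->
  exists i m', m = mnm_add (mnm1 i) m' /\ mdeg m' = k.
Proof.
move=> mk; have [i mi] : exists i, (0 < m i)%N.
  apply/existsP; apply: contra_eqT mk => /existsPn m0.
  rewrite mdegE big1// => i _; apply/eqP; have := m0 i; by rewrite -eqn0Ngt.
have im : lem (mnm1 i) m.
  by apply/mnm_lepP => j; rewrite mnm1E; case: eqP => // <-.
exists i, (mnm_sub m (mnm1 i)); split; first by rewrite addmC submK.
have := mk; rewrite -{1}(submK im) mdegD mdeg1 addn1 => -[]; exact.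
Qed.

Lemma cubic_monomial_split (m : cubic_monomial) :
  exists t : 'I_4 * 'I_4 * 'I_4,
    bmnm (val m) = mono3 t.1.1 t.1.2 t.2.
Proof.
have /eqP := valP m; set m0 := bmnm _.
move=> /mdeg_pos[i [m1 [-> /mdeg_pos[j [m2 [-> /mdeg_pos[k [m3 [-> /eqP]]]]]]]]].
by rewrite mdeg_eq0 => /eqP ->; exists (i, j, k); rewrite /mono3 addm0.
Qed.

Definition mon_idx (m : cubic_monomial) : 'I_4 * 'I_4 * 'I_4 :=
  sval (cid (cubic_monomial_split m)).
Definition mon1 m := (mon_idx m).1.1.
Definition mon2 m := (mon_idx m).1.2.
Definition mon3 m := (mon_idx m).2.

Lemma mon_idxE m :
  bmnm (val m) = mono3 (mon1 m) (mon2 m) (mon3 m).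
Proof. exact: svalP (cid (cubic_monomial_split m)). Qed.

Lemma mdeg_mono i j k : mdeg (mono3 i j k) = 3%N.
Proof. by rewrite /mono3 !mdegD !mdeg1. Qed.

Lemma mdeg_mono_lt i j k : (mdeg (mono3 i j k) < 4)%N.
Proof. by rewrite mdeg_mono. Qed.

Definition mono (i j k : 'I_4) : cubic_monomial :=
  exist _ (BMultinom (mdeg_mono_lt i j k)) (introT eqP (mdeg_mono i j k)).

Lemma mono_perm i j k : perm_eq
  [:: mon1 (mono i j k); mon2 (mono i j k); mon3 (mono i j k)] [:: i; j; k].
Proof.
(* [perm_eq] compares multiplicities, and these are the exponents of the two monomials. *)
apply/allP => x _; rewrite /= !addn0.
have /mnmP/(_ x) := mon_idxE (mono i j k).
by rewrite /= /mono3 !mnmDE !mnm1E => ->.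
Qed.

Lemma meval_cubic_of (A : nzRingType) (S : comNzRingType) (f : {rmorphism A -> S})
    (c : cubic_monomial -> A) (v : 'I_4 -> S) :
  meval v (map_mpoly f (cubic_of c)) = cub mon1 mon2 mon3 (f \o c) v.
Proof.
rewrite /cubic_of (raddf_sum (@map_mpoly 4 A S f)).
rewrite (big_morph _ (mevalD v) (meval0 v)).
apply: eq_bigr => m _.
rewrite /= map_mpolyZ mevalZ map_mpolyX mon_idxE /mono3 !mpolyXD !rmorphM /= !mevalXU.
by rewrite mulrA.
Qed.

End Monomials.

(* The first two entries of each row are the pivots.  The mask tells which
   non-pivot entries stand to the left of the pivot of their row: these vanish
   modulo p. *)
Definition chart_table : seq (seq nat) :=
  [:: [:: 0; 1; 2; 3]; [:: 0; 2; 1; 3]; [:: 0; 3; 1; 2];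
      [:: 1; 2; 0; 3]; [:: 1; 3; 0; 2]; [:: 2; 3; 0; 1]]%N.

(** A permutation of the coordinates taking positions 0 and 1 to the pivots. Composing the indices
    of the monomials with its inverse [chart_pos] reduces every chart to the normal form of [uvec]
    and [wvec]. *)
Definition chart (x : 'I_6) (a : 'I_4) : 'I_4 := inord (nth 0%N (nth [::] chart_table x) a).

Definition chart_pos (x : 'I_6) (i : 'I_4) : 'I_4 :=
  inord (index (i : nat) (nth [::] chart_table x)).

(** Entry e of A lies in row [odd e] and in column [2 + e./2]. *)
Definition chart_mask (x : 'I_6) (e : 'I_4) : bool :=
  let l := nth [::] chart_table x in
  (nth 0%N l (2 + e./2) < nth 0%N l (odd e))%N.

Lemma ord4P (P : 'I_4 -> Prop) : P 0 -> P 1 -> P o2 -> P o3 -> forall i, P i.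
Proof.
move=> P0 P1 P2 P3 [[|[|[|[|//]]]] i4].
- by rewrite (_ : Ordinal i4 = 0)//; exact: val_inj.
- by rewrite (_ : Ordinal i4 = 1)//; exact: val_inj.
- by rewrite (_ : Ordinal i4 = o2)//; exact: val_inj.
- by rewrite (_ : Ordinal i4 = o3)//; exact: val_inj.
Qed.

Lemma chart_posK x : cancel (chart x) (chart_pos x).
Proof.
move=> a; apply: val_inj; rewrite /chart_pos /chart.
by case: x => -[|[|[|[|[|[|//]]]]]] ? /=; case: a => -[|[|[|[|//]]]] ? /=;
  rewrite !inordK.
Qed.

Lemma chartK x : cancel (chart_pos x) (chart x).
Proof.
move=> a; apply: val_inj; rewrite /chart_pos /chart.
by case: x => -[|[|[|[|[|[|//]]]]]] ? /=; case: a => -[|[|[|[|//]]]] ? /=;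
  rewrite !inordK.
Qed.

Lemma chart_lt x : (chart x 0%R < chart x 1%R)%N.
Proof. by rewrite /chart; case: x => -[|[|[|[|[|[|//]]]]]] ? /=; rewrite !inordK. Qed.

Lemma chart_surj (i j : 'I_4) : (i < j)%N -> exists x, chart x 0%R = i /\ chart x 1%R = j.
Proof.
have mk (m : nat) (m6 : (m < 6)%N) : (nth 0%N (nth [::] chart_table m) 0 = i)%N ->
    (nth 0%N (nth [::] chart_table m) 1 = j)%N -> exists x, chart x 0%R = i /\ chart x 1%R = j.
  move=> mi mj; exists (Ordinal m6); rewrite /chart /= mi mj.
  by split; rewrite inord_val.
case: i mk => -[|[|[|[|//]]]] ? mk; case: j mk => -[|[|[|[|//]]]] ? mk // _.
- exact: (mk 0%N).
- exact: (mk 1%N).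
- exact: (mk 2%N).
- exact: (mk 3%N).
- exact: (mk 4%N).
- exact: (mk 5%N).
Qed.

Lemma chart_inj x y : chart x 0%R = chart y 0%R -> chart x 1%R = chart y 1%R -> x = y.
Proof.
move=> /(congr1 val) + /(congr1 val); rewrite /chart => h0 h1; apply: val_inj.
move: h0 h1; case: x => -[|[|[|[|[|[|//]]]]]] ?;
  by case: y => -[|[|[|[|[|[|//]]]]]] ? /=; rewrite !inordK.
Qed.

Lemma chart_maskE x : [/\ chart_mask x 0%R = (chart x o2 < chart x 0%R)%N,
  chart_mask x 1%R = (chart x o2 < chart x 1%R)%N,
  chart_mask x o2 = (chart x o3 < chart x 0%R)%N &
  chart_mask x o3 = (chart x o3 < chart x 1%R)%N].
Proof.
rewrite /chart_mask /chart.
by case: x => -[|[|[|[|[|[|//]]]]]] ? /=; rewrite !inordK.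
Qed.

(** The Gaussian binomial coefficient of 4 over 2, equal to (1 + r^2)(1 + r + r^2), summed over its
    Schubert cells. *)
Lemma sum_chart_mask (K : realFieldType) (r : K) :
  \sum_(x : 'I_6) r ^+ #|chart_mask x| = 1 + r + 2 * r ^+ 2 + r ^+ 3 + r ^+ 4.
Proof.
have cardE (P : pred 'I_4) : #|P| = (P 0%R + P 1%R + P o2 + P o3)%N.
  rewrite -sum1_card big_mkcond !big_ord_recl big_ord0 /= addn0 !addnA.
  rewrite (_ : lift ord0 ord0 = 1); last exact: val_inj.
  rewrite (_ : lift ord0 (lift ord0 ord0) = o2); last exact: val_inj.
  rewrite (_ : lift ord0 (lift ord0 (lift ord0 ord0)) = o3); last exact: val_inj.
  by rewrite !unfold_in; do 4!case: (P _).
rewrite !big_ord_recl big_ord0 !cardE /chart_mask /= !expr0 ?expr1; ring.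
Qed.

(** * Echelon bases of planes over Q_p *)

Section EchelonLines.
Variables (p : nat) (p_pr : prime p).
Local Notation Zp := (padic_int p_pr).
Local Notation F := (padic p_pr).
Local Notation iota := (@tofrac Zp).
Implicit Types (u w : 'I_4 -> Zp) (L : {vspace 'rV[F]_4}) (A : 'rV[Zp]_4).

Definition vec u : 'rV[F]_4 := \row_i iota (u i).

(* The row reduced echelon form modulo p, with pivots at i and j, of a basis of
   the lattice of integral points of a plane. *)
Record echelon (i j : 'I_4) u w : Prop := Echelon {
  ech_lt : (i < j)%N;
  ech_ui : u i = 1; ech_uj : u j = 0; ech_wi : w i = 0; ech_wj : w j = 1;
  ech_u : forall k : 'I_4, (k < i)%N -> red 0 (u k) = 0;
  ech_w : forall k : 'I_4, (k < j)%N -> red 0 (w k) = 0 }.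

Definition line_of u w : {vspace 'rV[F]_4} := <<[:: vec u; vec w]>>%VS.

Lemma memv_line_of u w v :
  reflect (exists s t, v = s *: vec u + t *: vec w) (v \in line_of u w).
Proof.
rewrite /line_of span_cons span_seq1; apply: (iffP memv_addP).
  by move=> [_ /vlineP[s ->] [_ /vlineP[t ->] ->]]; exists s, t.
move=> [s [t ->]]; exists (s *: vec u); first exact: memvZ (memv_line _).
by exists (t *: vec w) => //; exact: memvZ (memv_line _).
Qed.

Lemma dim_line_of i j u w : echelon i j u w -> \dim (line_of u w) = 2%N.
Proof.
move=> uw; have /eqP// : free [:: vec u; vec w].
rewrite free_cons seq1_free span_seq1; apply/andP; split; last first.
  apply/eqP => /rowP/(_ j); rewrite !mxE (ech_wj uw) rmorph1.
  by move/eqP; rewrite oner_eq0.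
apply/vlineP => -[s /rowP/(_ i)]; rewrite !mxE (ech_ui uw) (ech_wi uw).
by rewrite rmorph0 rmorph1 mulr0 => /eqP; rewrite oner_eq0.
Qed.

(** A vector of the plane is determined by its entries at the pivots i and j, and if it is integral
    and nonzero modulo p, its leading position modulo p is i or j. So the pivots agree, and the
    entries 0 and 1 there identify the basis vectors. *)
Lemma echelon_uniq i j u w i' j' u' w' : echelon i j u w -> echelon i' j' u' w' ->
  line_of u w = line_of u' w' -> [/\ i = i', j = j', u = u' & w = w'].
Proof.
move=> E E' L.
have comb (v : 'I_4 -> Zp) : vec v \in line_of u w ->
    v = fun k => v i * u k + v j * w k.
  move=> /memv_line_of[s [t vE]].
  have vk k : iota (v k) = s * iota (u k) + t * iota (w k).
    by have /rowP/(_ k) := vE; rewrite !mxE.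
  have sE : s = iota (v i) by rewrite vk (ech_ui E) (ech_wi E) rmorph1 rmorph0; ring.
  have tE : t = iota (v j) by rewrite vk (ech_uj E) (ech_wj E) rmorph1 rmorph0; ring.
  apply/funext => k; apply/eqP; rewrite -tofrac_eq rmorphD !rmorphM /= -sE -tE vk.
  exact/eqP.
have pivot (v : 'I_4 -> Zp) (k0 : 'I_4) : vec v \in line_of u w -> v k0 = 1 ->
    (forall k : 'I_4, (k < k0)%N -> red 0 (v k) = 0) -> k0 = i \/ k0 = j.
  move=> /comb vE v1 vk; have vE' k : red 0 (v k) =
      red 0 (v i) * red 0 (u k) + red 0 (v j) * red 0 (w k).
    by rewrite {1}vE rmorphD !rmorphM.
  have [vi|vi] := eqVneq (red 0 (v i)) 0.
    have vj : red 0 (v j) != 0.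
      apply: contra_eqN (v1) => /eqP vj; apply/eqP => v1'.
      by have := vE' k0; rewrite v1' vi vj !mul0r addr0 rmorph1 => /eqP; rewrite oner_eq0.
    right; apply/val_inj/eqP; rewrite /= eqn_leq; apply/andP; split.
      by rewrite leqNgt; apply: contra vj => /vk ->.
    rewrite leqNgt; apply/negP => /(ech_w E) wk0.
    by have := vE' k0; rewrite v1 vi wk0 mul0r mulr0 addr0 rmorph1 => /eqP; rewrite oner_eq0.
  left; apply/val_inj/eqP; rewrite /= eqn_leq; apply/andP; split.
    by rewrite leqNgt; apply: contra vi => /vk ->.
  rewrite leqNgt; apply/negP => k0i; have := vE' k0.
  rewrite v1 (ech_u E k0i) (ech_w E (ltn_trans k0i (ech_lt E))) !mulr0 addr0 rmorph1.
  by move/eqP; rewrite oner_eq0.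
have uL : vec u' \in line_of u w.
  by rewrite L; apply/memv_line_of; exists 1, 0; rewrite scale1r scale0r addr0.
have wL : vec w' \in line_of u w.
  by rewrite L; apply/memv_line_of; exists 0, 1; rewrite scale1r scale0r add0r.
have ii' := pivot _ _ uL (ech_ui E') (ech_u E').
have jj' := pivot _ _ wL (ech_wj E') (ech_w E').
have ij := ech_lt E; have ij' := ech_lt E'.
have [i'E j'E] : i' = i /\ j' = j.
  case: ii' jj' ij' => -> [] ->; rewrite ?ltnn//.
  by move=> /(ltn_trans ij); rewrite ltnn.
subst i' j'; split=> //; apply/funext => k.
  by rewrite (comb _ uL) (ech_ui E') (ech_uj E') mul1r mul0r addr0.
by rewrite (comb _ wL) (ech_wi E') (ech_wj E') mul1r mul0r add0r.
Qed.

Lemma frac_ex (x : F) : exists a b, b != 0 /\ iota b * x = iota a.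
Proof.
elim/quotW: x => f; exists (frac f).1, (frac f).2; split; first exact: denom_ratioP.
unlock tofrac; rewrite -[LHS]FracField.pi_mul; apply/eqmodP.
rewrite /= FracField.equivfE /FracField.mulf !numden_Ratio;
  rewrite ?(oner_neq0, mul1r, mulr1, denom_ratioP)//.
Qed.

(** Clear denominators, divide by the highest power of p common to all coordinates, then scale the
    first unit coordinate to 1. *)
Lemma vec_normalize (v : 'rV[F]_4) : v != 0 -> exists t (z : 'I_4 -> Zp) j,
  [/\ t *: v = vec z, z j = 1 &
    forall k : 'I_4, (k < j)%N -> red 0 (z k) = 0].
Proof.
move=> v0.
have [a aP] := boolp.choice (fun k => frac_ex (v 0 k)).
have [b bP] := boolp.choice aP.
pose D := \prod_k b k; pose y k := a k * \prod_(l | l != k) b l.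
have yE k : iota D * v 0 k = iota (y k).
  have [_ abk] := bP k.
  by rewrite /D /y (bigD1 k)//= rmorphM mulrAC abk -rmorphM.
have D0 : iota D != 0.
  by rewrite tofrac_eq0; apply/prodf_neq0 => k _; have [] := bP k.
have [k0 yk0] : exists k, y k != 0.
  apply/existsP; apply: contraNT v0 => /existsPn y0; apply/eqP/rowP => k.
  rewrite [RHS]mxE; apply: (mulfI D0); rewrite yE mulr0.
  by have := y0 k; rewrite negbK => /eqP ->; rewrite rmorph0.
pose P m := `[< forall k, exists z, y k = p%:R ^+ m * z >].
have exP : exists m, P m.
  by exists 0%N; apply/asboolP => k; exists (y k); rewrite expr0 mul1r.
have [e [u uU ye]] := exactv_ex yk0.
have leP m : P m -> (m <= e)%N.
  move=> /asboolP/(_ k0)[z yz]; rewrite leqNgt; apply/negP => em.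
  have : u = p%:R ^+ (m - e) * z.
    apply: (mulfI (pX_neq0 p_pr e)); rewrite -ye yz mulrA -exprD.
    by rewrite subnKC// ltnW.
  rewrite -(prednK (_ : 0 < m - e)%N) ?subn_gt0// exprS -mulrA => uE.
  have : red 0 u \is a GRing.unit by exact: rmorph_unit.
  rewrite pdvd_unit//; apply/negP; rewrite negbK uE.
  by apply/pdvd_redP => //; eexists; rewrite expr1.
case: (ex_maxnP exP leP) => m /asboolP mP m_max.
have [z zP] := boolp.choice mP.
have [k1 zk1] : exists k, red 0 (z k) != 0.
  apply/existsP; apply: contraT => /existsPn z0.
  have : P m.+1.
    apply/asboolP => k; have := z0 k; rewrite negbK => /eqP/red_eq0P[w zw].
    by exists w; rewrite zP zw expr1 exprSr mulrA.
  by move/m_max; rewrite ltnn.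
case: (arg_minnP (P := fun k => red 0 (z k) != 0) (fun k : 'I_4 => k : nat) zk1).
move=> j zj j_min; have zjU := red_unit zj.
exists ((iota (z j))^-1 * (iota (p%:R ^+ m))^-1 * iota D).
exists (fun k => (z j)^-1 * z k), j; split.
- apply/rowP => k; rewrite !mxE -!mulrA yE zP rmorphM.
  have pm0 : iota (p%:R ^+ m) != 0 by rewrite tofrac_eq0 pX_neq0.
  have zj0 : iota (z j) != 0.
    by rewrite tofrac_eq0; apply: contraNneq zj => ->; rewrite rmorph0.
  rewrite mulKf//; apply: (mulfI zj0); rewrite mulrA mulfV// mul1r.
  by rewrite -rmorphM mulVKr.
- by rewrite mulVr.
- move=> k kj; rewrite rmorphM /= (_ : red 0 (z k) = 0) ?mulr0//; apply/eqP/negPn/negP.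
  by move=> /j_min; rewrite leqNgt kj.
Qed.

(** Gaussian elimination with the least possible leading position i. Normalizing a vector with entry
    0 at i gives w, whose leading position j exceeds i by minimality; subtracting a multiple of w
    then clears entry j of the first vector and keeps its leading position. *)
Lemma echelon_ex L : \dim L = 2%N ->
  exists i j u w, echelon i j u w /\ L = line_of u w.
Proof.
move=> dimL.
pose lead j := `[< exists2 z : 'I_4 -> Zp, vec z \in L & z j = 1 /\
  forall k : 'I_4, (k < j)%N -> red 0 (z k) = 0 >].
have vec_nz (z : 'I_4 -> Zp) k : z k != 0 -> vec z != 0.
  by apply: contraNneq => /rowP/(_ k); rewrite !mxE => /eqP; rewrite tofrac_eq0.
have lead_ex v : v \in L -> v != 0 -> exists t z j, [/\ t *: v = vec z, z j = 1,
    lead j & forall k : 'I_4, (k < j)%N -> red 0 (z k) = 0].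
  move=> vL /vec_normalize[t [z [j [tv zj zk]]]]; exists t, z, j; split=> //.
  by apply/asboolP; exists z => //; rewrite -tv memvZ.
have [j0 lead0] : exists j, lead j.
  have : vpick L \in L := memv_pick L.
  move/lead_ex => []; first by rewrite vpick0 -dimv_eq0 dimL.
  by move=> t [z [j [_ _ ? _]]]; exists j.
case: (arg_minnP (P := lead) (fun k : 'I_4 => k : nat) lead0) => i /asboolP[u0 uL [ui u0k]] i_min.
have [v vL vu] : exists2 v, v \in L & v \notin <[vec u0]>%VS.
  apply/subvPn; apply/negP => /dimvS; rewrite dimL dim_vline.
  by rewrite (vec_nz _ i) ?ui ?oner_neq0.
pose v1 := v - v 0 i *: vec u0.
have v1L : v1 \in L by rewrite memvB// memvZ.
have v10 : v1 != 0.
  by apply: contraNneq vu => /eqP; rewrite subr_eq0 => /eqP ->; rewrite memvZ ?memv_line.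
have [t [w [j [tw wj lj wk]]]] := lead_ex _ v1L v10.
have wi : w i = 0.
  apply/eqP; rewrite -tofrac_eq0; have /rowP/(_ i) := tw; rewrite !mxE ui rmorph1 => <-.
  by rewrite mulr1 subrr mulr0.
have ij : (i < j)%N.
  rewrite ltn_neqAle i_min// andbT; apply/eqP => /val_inj ij.
  by move: wi; rewrite ij wj => /eqP; rewrite oner_eq0.
pose u k := u0 k - u0 j * w k.
have E : echelon i j u w.
  split=> //; rewrite /u ?wi ?wj ?ui; [ring|ring|].
  move=> k ki; rewrite rmorphB rmorphM /= (u0k k ki) (wk k (ltn_trans ki ij)).
  by rewrite mulr0 subrr.
exists i, j, u, w; split=> //.
apply/esym/eqP; rewrite eqEdim dimL (dim_line_of E) leqnn andbT.
have wL : vec w \in L by rewrite -tw memvZ.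
apply/span_subvP => x; rewrite !inE => /orP[]/eqP ->//.
rewrite (_ : vec u = vec u0 - iota (u0 j) *: vec w); first by rewrite memvB// memvZ.
by apply/rowP => k; rewrite !mxE rmorphB rmorphM.
Qed.

Definition line_vecs (x : 'I_6) A : ('I_4 -> Zp) * ('I_4 -> Zp) :=
  (uvec A \o chart_pos x, wvec A \o chart_pos x).

Definition chart_line (x : 'I_6) A : {vspace 'rV[F]_4} :=
  line_of (line_vecs x A).1 (line_vecs x A).2.

Lemma line_vecs_echelon x A : (forall e, chart_mask x e -> red 0 (A 0 e) = 0) ->
  echelon (chart x 0%R) (chart x 1%R) (line_vecs x A).1 (line_vecs x A).2.
Proof.
move=> mA; have [m0 m1 m2 m3] := chart_maskE x; split; rewrite /= ?chart_posK//.
- exact: chart_lt.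
- move=> k; rewrite -(chartK x k) chart_posK; elim/ord4P: (chart_pos x k).
  + by rewrite ltnn.
  + by move=> /(ltn_trans (chart_lt x)); rewrite ltnn.
  + by rewrite -m0 => /mA.
  + by rewrite -m2 => /mA.
- move=> k; rewrite -(chartK x k) chart_posK; elim/ord4P: (chart_pos x k).
  + by rewrite /wvec /= rmorph0.
  + by rewrite ltnn.
  + by rewrite -m1 => /mA.
  + by rewrite -m3 => /mA.
Qed.

Lemma chart_line_inj x A y (B : 'rV[Zp]_4) : (forall e, chart_mask x e -> red 0 (A 0 e) = 0) ->
  (forall e, chart_mask y e -> red 0 (B 0 e) = 0) ->
  chart_line x A = chart_line y B -> x = y /\ A = B.
Proof.
move=> mA mB /(echelon_uniq (line_vecs_echelon mA) (line_vecs_echelon mB)).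
move=> [h0 h1 hu hw]; have xy := chart_inj h0 h1; subst y; split=> //.
have hu' a : uvec A a = uvec B a.
  by have := congr1 (fun f => f (chart x a)) hu; rewrite /= chart_posK.
have hw' a : wvec A a = wvec B a.
  by have := congr1 (fun f => f (chart x a)) hw; rewrite /= chart_posK.
apply/rowP; elim/ord4P; [exact: (hu' o2)|exact: (hw' o2)|exact: (hu' o3)|exact: (hw' o3)].
Qed.

Lemma chart_line_surj L : \dim L = 2%N -> exists x A,
  (forall e, chart_mask x e -> red 0 (A 0 e) = 0) /\ L = chart_line x A.
Proof.
move=> /echelon_ex[i [j [u [w [E LE]]]]].
have [x [xi xj]] := chart_surj (ech_lt E).
pose A : 'rV[Zp]_4 := \row_e nth 0 [:: u (chart x o2); w (chart x o2);
  u (chart x o3); w (chart x o3)] e.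
have [m0 m1 m2 m3] := chart_maskE x.
exists x, A; split.
  elim/ord4P; rewrite ?m0 ?m1 ?m2 ?m3 ?xi ?xj mxE /= => h.
  - exact: ech_u E _ h.
  - exact: ech_w E _ h.
  - exact: ech_u E _ h.
  - exact: ech_w E _ h.
rewrite LE /chart_line; congr line_of; apply/funext => k /=.
  rewrite -{1}(chartK x k); elim/ord4P: (chart_pos x k); rewrite /uvec /= ?mxE//.
    by rewrite xi (ech_ui E).
  by rewrite xj (ech_uj E).
rewrite -{1}(chartK x k); elim/ord4P: (chart_pos x k); rewrite /wvec /= ?mxE//.
  by rewrite xi (ech_wi E).
by rewrite xj (ech_wj E).
Qed.

End EchelonLines.

(* The library states that counting is a measure only on a measurable type; a
   type of this name carries the power set. *)
Definition discrete_type (T : pointedType) : Type := T.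

HB.instance Definition _ (T : pointedType) := Pointed.on (discrete_type T).
HB.instance Definition _ (T : pointedType) :=
  @isMeasurable.Build default_measure_display (discrete_type T)
    discrete_measurable discrete_measurable0 discrete_measurableC
    discrete_measurableU.

Section Counting.
Variable K : realType.
Local Open Scope ereal_scope.

Lemma counting_image (T T' : choiceType) (f : T -> T') (A : set T) :
  {in A &, injective f} -> counting (f @` A) = counting A :> \bar K.
Proof.
move=> finj; rewrite /counting; have fA := inj_card_eq finj.
have [Afin|Ainf] := pselect (finite_set A); last first.
  by rewrite !asboolF// (eq_finite_set fA).
rewrite !asboolT//; last exact: finite_image.
by congr (_%:R%:E); apply/(fcard_eq _ Afin) => //; exact: finite_image.
Qed.

Lemma counting_bigcup (T : pointedType) (F : (set T)^nat) :
  trivIset setT F -> counting (\bigcup_k F k) = \sum_(k <oo) counting (F k) :> \bar K.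
Proof.
pose mu : {measure set (discrete_type T) -> \bar K} := @counting (discrete_type T) K.
by move=> tF; have := @measure_semi_bigcup _ K (discrete_type T) mu F (fun=> I) tF I.
Qed.

Lemma counting_bigsetU (T : pointedType) n (F : 'I_n -> set T) :
  trivIset setT F ->
  counting (\big[setU/set0]_(i < n) F i) = \sum_(i < n) counting (F i) :> \bar K.
Proof.
pose mu : {measure set (discrete_type T) -> \bar K} := @counting (discrete_type T) K.
by move=> tF; have := @measure_bigsetU_ord _ K (discrete_type T) mu n xpredT F (fun=> I) tF.
Qed.

End Counting.

HB.instance Definition _ n := isPointed.Build 'I_n.+1 ord0.

(** * Lines on a cubic as zeros in the charts *)

Section LinesOnCubic.
Variables (p : nat) (p_pr : prime p).
Local Notation Zp := (padic_int p_pr).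
Local Notation F := (padic p_pr).
Local Notation iota := (@tofrac Zp).
Implicit Types (c : cubic_monomial -> Zp) (u w : 'I_4 -> Zp) (A : 'rV[Zp]_4).

Lemma cub_comb (S : comNzRingType) (M : finType) (i1 i2 i3 : M -> 'I_4)
    (c : M -> S) (u w : 'I_4 -> S) s t :
  cub i1 i2 i3 c (fun i => s * u i + t * w i) =
  s ^+ 3 * cub i1 i2 i3 c u + s ^+ 2 * t * dcub i1 i2 i3 c u w
  + s * t ^+ 2 * dcub i1 i2 i3 c w u + t ^+ 3 * cub i1 i2 i3 c w.
Proof.
rewrite /cub /dcub /tri !(mulrDr, mulr_sumr) -!big_split /=.
by apply: eq_bigr => m _; ring.
Qed.

Local Notation cub3 := (cub mon1 mon2 mon3).
Local Notation dcub3 := (dcub mon1 mon2 mon3).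

(** The values at (1, 0), (0, 1), (1, 1) and (1, -1) determine a binary cubic form as soon as 2 is
    nonzero, which holds in characteristic 0, even for p = 2. *)
Lemma cubic_vanish_line c u w :
  (forall v : 'rV[F]_4, v \in line_of u w ->
    mpoly.meval (fun i => v 0 i) (mpoly.map_mpoly iota (cubic_of c)) = 0) <->
  [/\ cub3 c u = 0, dcub3 c u w = 0, dcub3 c w u = 0 & cub3 c w = 0].
Proof.
have iotaE (x : Zp) : iota x = 0 <-> x = 0.
  by split=> [/eqP|->]; rewrite ?rmorph0// tofrac_eq0 => /eqP.
have cubE s t : mpoly.meval (fun i => (s *: vec u + t *: vec w) 0 i)
    (mpoly.map_mpoly iota (cubic_of c)) =
    s ^+ 3 * iota (cub3 c u) + s ^+ 2 * t * iota (dcub3 c u w)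
    + s * t ^+ 2 * iota (dcub3 c w u) + t ^+ 3 * iota (cub3 c w).
  rewrite meval_cubic_of (_ : (fun i => _) = fun i => s * iota (u i) + t * iota (w i)).
    rewrite cub_comb /cub /dcub !rmorphD /= -!rmorph_tri; reflexivity.
  by apply/funext => i; rewrite !mxE.
split=> [h|[h1 h2 h3 h4] v /memv_line_of[s [t ->]]]; last first.
  by rewrite cubE h1 h2 h3 h4 !rmorph0 !mulr0 !addr0.
have {}h s t : s ^+ 3 * iota (cub3 c u) + s ^+ 2 * t * iota (dcub3 c u w)
    + s * t ^+ 2 * iota (dcub3 c w u) + t ^+ 3 * iota (cub3 c w) = 0.
  by rewrite -cubE; apply: h; apply/memv_line_of; exists s, t.
have h1 : iota (cub3 c u) = 0 by rewrite -(h 1 0); ring.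
have h4 : iota (cub3 c w) = 0 by rewrite -(h 0 1); ring.
have h2 : 2%:R * iota (dcub3 c w u) = 0.
  transitivity (0 + 0 : F); last by rewrite addr0.
  by rewrite -{1}(h 1 1) -(h 1 (-1)) h1 h4; ring.
have h2' : iota (dcub3 c w u) = 0.
  have two : (2%:R : F) != 0.
    by rewrite -(rmorph_nat (@tofrac Zp)) tofrac_eq0 natp_neq0.
  by apply: (mulfI two); rewrite h2 mulr0.
have h3 : iota (dcub3 c u w) = 0.
  by rewrite -(h 1 1) h1 h4 h2'; ring.
by split; apply/iotaE.
Qed.

Local Notation "'pos1' x" := (chart_pos x \o mon1) (at level 10, x at level 9).
Local Notation "'pos2' x" := (chart_pos x \o mon2) (at level 10, x at level 9).
Local Notation "'pos3' x" := (chart_pos x \o mon3) (at level 10, x at level 9).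

Definition zeros x c := chart_zeros (pos1 x) (pos2 x) (pos3 x) (chart_mask x) c.
Definition regular_zeros x k c :=
  exact_zeros (pos1 x) (pos2 x) (pos3 x) (chart_mask x) k c.
Definition degenerate c := exists x A,
  restr (pos1 x) (pos2 x) (pos3 x) c A = 0 /\
  \det (jac (pos1 x) (pos2 x) (pos3 x) c A) = 0.

Lemma chart_line_vanish c x A :
  (forall v : 'rV[F]_4, v \in chart_line x A ->
    mpoly.meval (fun i => v 0 i) (mpoly.map_mpoly iota (cubic_of c)) = 0) <->
  restr (pos1 x) (pos2 x) (pos3 x) c A = 0.
Proof.
rewrite cubic_vanish_line; split=> [[h1 h2 h3 h4]|/rowP h].
  by apply/rowP => j; rewrite mxE [RHS]mxE; elim/ord4P: j.
by have := (h 0, h 1, h o2, h o3); rewrite !mxE /= => -[[[]]].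
Qed.

Lemma padic_lines_onE c : padic_lines_on (cubic_of c) =
  (fun u : 'I_6 * 'rV[Zp]_4 => chart_line u.1 u.2) @` [set u | zeros u.1 c u.2].
Proof.
apply/seteqP; split=> [L [dimL Lc]|_ [[x A] [/= cA mA] <-]].
  have [x [A [mA LE]]] := chart_line_surj dimL.
  by exists (x, A) => //; split=> //=; apply/chart_line_vanish; rewrite -LE.
split; last exact/chart_line_vanish.
exact: dim_line_of (line_vecs_echelon mA).
Qed.

(** The valuation k is the outer index, so that the series can be integrated term by term. *)
Lemma counting_lines (K : realType) c : ~ degenerate c ->
  counting (padic_lines_on (cubic_of c)) =
  (\sum_(k <oo) \sum_(x < 6) counting (regular_zeros x k c) : \bar K)%E.
Proof.
move=> ndeg; rewrite padic_lines_onE counting_image; last first.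
  move=> [x A] [y B] /set_mem[/= _ mA] /set_mem[/= _ mB].
  by move=> /(chart_line_inj mA mB)[-> ->].
rewrite (_ : [set u | _] =
  \bigcup_k [set u : 'I_6 * 'rV[Zp]_4 | regular_zeros u.1 k c u.2]); last first.
  apply/seteqP; split=> [[x A] /= Az|[x A] [k _ [Az _]]//].
  have /exactv_ex[k Ak] : \det (jac (pos1 x) (pos2 x) (pos3 x) c A) != 0.
    by apply/eqP => dA; apply: ndeg; exists x, A; have [cA _] := Az.
  by exists k.
rewrite counting_bigcup//; last first.
  apply/trivIsetP => i j _ _ ij; apply/seteqP; split=> // -[x A] [[_ hi] [_ hj]].
  move: hi hj => /(exactvP _ (leq_maxl i j)) /andP[i1 i2].
  move=> /(exactvP _ (leq_maxr i j)) /andP[j1 j2].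
  case: (ltngtP i j) ij => // ij _.
    by move: i2; rewrite (pdvdW ij j1).
  by move: j2; rewrite (pdvdW ij i1).
apply: eq_eseriesr => k _.
rewrite (_ : [set u | _] = \big[setU/set0]_(x < 6) (pair x @` regular_zeros x k c)); last first.
  rewrite -bigcup_seq; apply/seteqP; split=> [[x A] /= Az|_ [x _ [A Az <-]]//].
  by exists x; [rewrite /= mem_index_enum|exists A].
rewrite counting_bigsetU//; last first.
  apply/trivIsetP => i j _ _ ij; apply/seteqP; split=> // _ [[A _ <-]].
  by move=> [B _ /(congr1 fst) /= /eqP]; rewrite eq_sym (negbTE ij).
by apply: eq_bigr => x _; rewrite counting_image// => A B _ _ /(congr1 snd).
Qed.

End LinesOnCubic.

(** * The expectation *)

Section UniformLaw.
Variables (K : realType) (p : nat) (p_pr : prime p).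
Local Notation Zp := (padic_int p_pr).
Variables (haar : probability (padic_borel p_pr) K) (haarP : is_haar haar).

Definition red_fiber n (z : 'Z_(p ^ n.+1)) : set (padic_borel p_pr) :=
  [set x | red n (x : Zp) = z].

Lemma measurable_red_fiber n z : measurable (@red_fiber n z).
Proof.
apply: sub_sigma_algebra; change (padic_open (@red_fiber n z)) => a az.
by exists n => x xa; rewrite /red_fiber /= -az; exact: xa.
Qed.

(** The p^(n+1) fibres partition Z_p and are translates of one another. *)
Lemma haar_red_fiber n z : haar (@red_fiber n z) = (((p ^ n.+1)%:R)^-1)%:E.
Proof.
have trans z' : haar (@red_fiber n z') = haar (@red_fiber n 0).
  have [a az] := red_surj p_pr z'.
  rewrite -(haarP a (measurable_red_fiber 0)); congr (haar _).
  apply/seteqP; split=> [x xz|_ [x x0 <-]]; rewrite /red_fiber /=.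
    exists ((x : Zp) - a); last by rewrite addrC subrK.
    change (red n ((x : Zp) - a) = 0).
    by rewrite rmorphB /= az -[red n x]/(red n (x : Zp)) xz subrr.
  change (red n (a + (x : Zp)) = z').
  by rewrite rmorphD /= az (x0 : red n (x : Zp) = 0) addr0.
have fin : haar (@red_fiber n 0) \is a fin_num.
  by rewrite fin_num_measure//; exact: measurable_red_fiber.
have := probability_setT haar.
have -> : setT = \big[setU/set0]_(z' : 'Z_(p ^ n.+1)) @red_fiber n z'.
  rewrite -bigcup_seq; apply/seteqP; split=> // x _.
  by exists (red n (x : Zp)) => //=; rewrite mem_index_enum.
rewrite measure_bigsetU_ord//; last 2 first.
- by move=> i; exact: measurable_red_fiber.
- apply/trivIsetP => i j _ _ ij; apply/seteqP; split=> // x [] /= xi xj.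
  by move: ij; rewrite -xi -xj eqxx.
rewrite (eq_bigr (fun=> haar (@red_fiber n 0))) => [|z' _]; last exact: trans.
rewrite trans -(fineK fin) sumEFin sumr_const card_R// => -[h].
congr (_%:E); apply: (mulfI (_ : (p ^ n.+1)%:R != 0)).
  by rewrite pnatr_eq0 -lt0n expn_gt0 prime_gt0.
rewrite mulfV ?pnatr_eq0 -?lt0n ?expn_gt0 ?prime_gt0//.
by rewrite mulr_natl.
Qed.

Context d (Omega : measurableType d) (P : probability Omega K).
Variable xi : cubic_monomial -> {RV P >-> padic_borel p_pr}.
Hypothesis xi_indep : mutually_independent xi.
Hypothesis xi_uniform : forall (m : cubic_monomial) (A : set (padic_borel p_pr)),
  measurable A -> distribution P (xi m) A = haar A.

Local Notation q n := (p ^ n.+1)%N.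
Local Notation coef w := (fun m => xi m w : Zp).
Local Notation C n := {ffun cubic_monomial -> 'Z_(p ^ n.+1)}.

Definition red_coef n (w : Omega) : C n := [ffun m => red n (xi m w : Zp)].

Definition coef_fiber n (c : C n) : set Omega := [set w | red_coef n w = c].

Lemma coef_fiberE n c : @coef_fiber n c =
  \bigcap_(m in [set` [set: cubic_monomial]%SET]) (xi m @^-1` red_fiber (c m)).
Proof.
apply/seteqP; split=> [w /= <- m _|w wc]; first by rewrite /= /red_fiber /= ffunE.
by apply/ffunP => m; rewrite ffunE; apply: wc; rewrite /= inE.
Qed.

Lemma measurable_coef_fiber n c : measurable (@coef_fiber n c).
Proof.
rewrite coef_fiberE; apply: fin_bigcap_measurable => [|m _]; first exact: finite_finset.
rewrite -[X in measurable X]setTI; apply: measurable_funPT => //.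
exact: measurable_red_fiber.
Qed.

Lemma prob_coef_fiber n c :
  P (@coef_fiber n c) = (((q n)%:R)^-1 ^+ #|{: cubic_monomial}|)%:E.
Proof.
rewrite coef_fiberE xi_indep => [|m]; last exact: measurable_red_fiber.
rewrite (eq_bigr (fun=> (((q n)%:R)^-1)%:E)) => [|m _].
  by rewrite prodEFin prodr_const cardsT.
rewrite -(haar_red_fiber (c m)) -(xi_uniform m) //; exact: measurable_red_fiber.
Qed.

Lemma measurable_red_coef n (Q : pred (C n)) : measurable [set w | Q (red_coef n w)].
Proof.
rewrite (_ : [set w | _] = \bigcup_(c in [set` Q]) coef_fiber c).
  by apply: fin_bigcup_measurable => // c _; exact: measurable_coef_fiber.
apply/seteqP; split=> [w Qw|w [c Qc wc]]; first by exists (red_coef n w).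
by rewrite /= wc.
Qed.

Lemma red_coef_sum n (h : C n -> K) w :
  (h (red_coef n w))%:E = (\sum_(c : C n) (h c)%:E * (\1_(coef_fiber c) w)%:E)%E.
Proof.
rewrite (bigD1 (red_coef n w))//= big1 ?adde0 => [|c /negbTE nc].
  by rewrite indicE mem_set// mule1.
by rewrite indicE memNset ?mule0// => wc; move: nc; rewrite -[c]wc eqxx.
Qed.

Lemma measurable_red_coef_fun n (h : C n -> K) :
  measurable_fun setT ((fun w => (h (red_coef n w))%:E) : Omega -> \bar K).
Proof.
under eq_fun do rewrite red_coef_sum.
apply: emeasurable_sum => c; apply: measurable_funeM.
by apply/measurable_EFinP; exact: measurable_indic (measurable_coef_fiber c).
Qed.

Lemma integral_red_coef n (h : C n -> K) : (forall c, 0 <= h c) ->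
  (\int[P]_w (h (red_coef n w))%:E)%E =
  ((q n)%:R^-1 ^+ #|{: cubic_monomial}| * \sum_c h c)%:E.
Proof.
move=> h0; under eq_integral do rewrite red_coef_sum.
rewrite ge0_integral_sum//; last 2 first.
- move=> c; apply: measurable_funeM.
  by apply/measurable_EFinP; exact: measurable_indic (measurable_coef_fiber c).
- by move=> c w _; rewrite mule_ge0 ?lee_fin.
rewrite mulr_sumr -sumEFin; apply: eq_bigr => c _.
rewrite ge0_integralZl_EFin//; last first.
  by apply/measurable_EFinP; exact: measurable_indic (measurable_coef_fiber c).
rewrite integral_indic//; last exact: measurable_coef_fiber.
rewrite setIT mulrC EFinM; congr (_ * _)%E; exact: prob_coef_fiber.
Qed.

End UniformLaw.

Section Sandwich.
Variables (K : realType) (d : measure_display) (T : measurableType d).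
Variable mu : {measure set T -> \bar K}.
Local Open Scope ereal_scope.

Lemma ge0_le_integralT (f g : T -> \bar K) : (forall w, 0 <= f w) ->
  (forall w, f w <= g w) -> \int[mu]_w f w <= \int[mu]_w g w.
Proof.
move=> f0 fg; rewrite !ge0_integralTE// => [|w]; last exact: le_trans (fg w).
apply: le_ereal_sup => _ [h hf <-]; exists h => // w.
exact: le_trans (hf w) (fg w).
Qed.

(* [f] need not be measurable: the integral of a nonnegative function is the
   supremum over the simple functions below it. *)
Lemma integral_null_modification (f g : T -> \bar K) (N : set T) :
  measurable N -> mu N = 0 -> measurable_fun setT g ->
  (forall w, 0 <= f w) -> (forall w, 0 <= g w) ->
  (forall w, ~ N w -> f w = g w) -> \int[mu]_w f w = \int[mu]_w g w.
Proof.
move=> mN muN mg f0 g0 fg.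
(* Changing g on N to a constant y keeps the integral; y = 0 and y = +oo give measurable bounds for
   f from below and above. *)
have patch y : 0 <= y -> \int[mu]_w (if w \in N then y else g w) = \int[mu]_w g w.
  move=> y0; have m : measurable_fun setT (fun w => if w \in N then y else g w).
    apply: measurable_fun_if => //.
      apply: (measurable_fun_bool true).
      rewrite setTI (_ : _ @^-1` _ = N)//.
      by apply/seteqP; split=> w; [exact: set_mem|exact: mem_set].
    exact: measurable_funS mg.
  apply: ge0_ae_eq_integral => // [w _|]; first by case: ifP.
  exists N; split=> // w /=; apply: contra_notP => Nw _.
  by rewrite memNset.
apply/eqP; rewrite eq_le; apply/andP; split.
  rewrite -(patch +oo)//; apply: ge0_le_integralT => // w.
  by case: ifPn => [_|/negP Nw]; rewrite ?leey// fg// => /mem_set.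
rewrite -(patch 0)//; apply: ge0_le_integralT => // w; first by case: ifP.
by case: ifPn => // /negP Nw; rewrite fg// => /mem_set.
Qed.

End Sandwich.

(** * Means of regular zeros and rarity of singular ones *)

Section ZeroExpectation.
Variables (K : realType) (p : nat) (p_pr : prime p).
Local Notation Zp := (padic_int p_pr).
Variables (haar : probability (padic_borel p_pr) K) (haarP : is_haar haar).
Context d (Omega : measurableType d) (P : probability Omega K).
Variable xi : cubic_monomial -> {RV P >-> padic_borel p_pr}.
Hypothesis xi_indep : mutually_independent xi.
Hypothesis xi_uniform : forall (m : cubic_monomial) (A : set (padic_borel p_pr)),
  measurable A -> distribution P (xi m) A = haar A.

Local Notation coef w := (fun m => xi m w : Zp).
Local Notation C n := {ffun cubic_monomial -> 'Z_(p ^ n.+1)}.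
Local Notation pos1 x := (chart_pos x \o mon1).
Local Notation pos2 x := (chart_pos x \o mon2).
Local Notation pos3 x := (chart_pos x \o mon3).
Local Notation r := (p%:R^-1 : K).

Lemma chart_mono (x : 'I_6) i j k :
  let m := mono (chart x i) (chart x j) (chart x k) in
  perm_eq [:: pos1 x m; pos2 x m; pos3 x m] [:: i; j; k].
Proof.
have := perm_map (chart_pos x) (mono_perm (chart x i) (chart x j) (chart x k)).
by rewrite /= !chart_posK.
Qed.

Let q_neq0 n : (p ^ n.+1)%:R != 0 :> K.
Proof. by rewrite pnatr_eq0 -lt0n expn_gt0 prime_gt0. Qed.

Definition zero_count n (Q : pred 'Z_(p ^ n.+1)) x (msk : pred 'I_4) (c : C n) :=
  #|[pred B : 'rV_4 | [&& restr (pos1 x) (pos2 x) (pos3 x) c B == 0,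
    Q (\det (jac (pos1 x) (pos2 x) (pos3 x) c B)) & mask_mod msk B]]|.

Lemma sum_zero_count n Q x msk :
  (p ^ n.+1)%:R^-1 ^+ #|{: cubic_monomial}| * \sum_c (@zero_count n Q x msk c)%:R
  = r ^+ #|msk| * (#|[pred u | Q (bres u.1 u.2)]|%:R / (p ^ n.+1)%:R ^+ 6).
Proof.
rewrite (sum_approx p_pr (chart_mono x)) exprVn.
have q0 : (p ^ n.+1)%:R ^+ #|{: cubic_monomial}| != 0 :> K.
  exact: expf_neq0 (q_neq0 _).
by rewrite !mulrA mulVf// mul1r.
Qed.

Definition regular_count k (w : Omega) : \bar K :=
  (\sum_(x < 6) counting (regular_zeros x k (coef w)))%E.

(** [2 * k] is the lowest level at which [counting_exact_zeros] applies. *)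
Let regular_mean k (c : C (2 * k)) : K :=
  \sum_(x < 6) (zero_count (pexact k) x (chart_mask x) c)%:R / p%:R ^+ k.

Lemma regular_countE k w :
  regular_count k w = (regular_mean (red_coef xi (2 * k) w))%:E.
Proof.
have wE : (red_coef xi (2 * k) w : _ -> _) = red (2 * k) \o coef w.
  by apply/funext => m; rewrite ffunE.
rewrite /regular_count /regular_mean /zero_count wE -sumEFin.
by apply: eq_bigr => x _; exact: counting_exact_zeros (leqnn (2 * k)) _ _.
Qed.

Lemma measurable_regular_count k : measurable_fun setT (regular_count k).
Proof.
rewrite (funext (regular_countE k)); exact: measurable_red_coef_fun.
Qed.

Lemma integral_regular_count k : (\int[P]_w regular_count k w =
  ((\sum_(x < 6) r ^+ #|chart_mask x|) *
   (r ^+ k * (prob_res K p k - prob_res K p k.+1)))%:E)%E.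
Proof.
under eq_integral do rewrite regular_countE.
rewrite (integral_red_coef haarP xi_indep xi_uniform) => [|c]; last first.
  by apply: sumr_ge0 => x _; rewrite divr_ge0// exprn_ge0.
congr (_%:E); rewrite exchange_big mulr_sumr mulr_suml; apply: eq_bigr => x _.
rewrite -mulr_suml [LHS]mulrA sum_zero_count card_pexact_bres ?leq_pmull//.
have q0 : (p ^ (2 * k).+1)%:R ^+ 6 != 0 :> K.
  exact: expf_neq0 (q_neq0 _).
by rewrite [X in _ * X / _]mulrAC mulfV// mul1r -[LHS]mulrA [X in _ * X]mulrC -exprVn.
Qed.

(** The mask is empty because [degenerate] imposes no divisibility on A. *)
Definition singular_mod n (c : C n) :=
  [exists x : 'I_6, (0 < zero_count (pred1 0%R) x pred0 c)%N].

Lemma degenerate_singular_mod n w :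
  degenerate (coef w) -> singular_mod (red_coef xi n w).
Proof.
move=> [x [A [FA JA]]]; apply/existsP; exists x; apply/card_gt0P.
exists (map_mx (red n) A); rewrite inE.
have -> : (red_coef xi n w : _ -> _) = red n \o coef w.
  by apply/funext => m; rewrite ffunE.
rewrite rmorph_restr rmorph_jac det_map_mx FA JA map_mx0 rmorph0 /= !eqxx.
by apply/forallP.
Qed.

(** First moment bound: the mean number of singular zeros modulo p^(n+1) in a chart is the
    probability that p^(n+1) divides the resultant. The constant 48 is 6 charts times the 8 of
    [prob_res_le]. *)
Lemma prob_singular_mod n :
  (P [set w | singular_mod (red_coef xi n w)] <= (48%:R * (3 / 4) ^+ n.+1)%:E)%E.
Proof.
have mS : measurable [set w | singular_mod (red_coef xi n w)].
  exact: measurable_red_coef.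
rewrite -[X in P X]setIT -integral_indic//.
under eq_integral => w _.
  rewrite (_ : \1__ _ = (singular_mod (red_coef xi n w))%:R); last first.
    by rewrite indicE mem_setE.
  over.
rewrite (@integral_red_coef _ _ _ _ haarP _ _ _ _ xi_indep xi_uniform n
  (fun c => (singular_mod c)%:R))// lee_fin.
have -> : 48%:R * (3 / 4) ^+ n.+1 = \sum_(x < 6) 8%:R * (3 / 4) ^+ n.+1 :> K.
  by rewrite sumr_const card_ord -mulrnAl -mulrnA.
apply: (@le_trans _ _ (\sum_(x < 6) prob_res K p n.+1)); last first.
  by apply: ler_sum => x _; exact: prob_res_le.
have -> : \sum_(x < 6) prob_res K p n.+1 = (p ^ n.+1)%:R^-1 ^+ #|{: cubic_monomial}|
    * \sum_c \sum_(x < 6) (@zero_count n (pred1 0%R) x pred0 c)%:R.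
  rewrite exchange_big mulr_sumr; apply: eq_bigr => x _.
  rewrite sum_zero_count card0 mul1r.
  have q0 : (p ^ n.+1)%:R ^+ 6 != 0 :> K.
    exact: expf_neq0 (q_neq0 _).
  apply: (mulIf q0); rewrite mulfVK// mulrC -card_pdvd_bres//.
  congr (_%:R); apply: eq_card => u; rewrite !inE.
  by have := pX_mul_eq0 p_pr (i := 0) (bres u.1 u.2) isT; rewrite mul1r subn0 => ->.
apply: ler_wpM2l; first by rewrite exprn_ge0// invr_ge0.
apply: ler_sum => c _; rewrite -natr_sum ler_nat.
case: (boolP (singular_mod c)) => // /existsP[x cx]; rewrite (bigD1 x)//=.
exact: leq_trans (leq_addr _ _).
Qed.

End ZeroExpectation.

Lemma counting_ge0 (K : realType) (T : choiceType) (A : set T) :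
  (0 <= counting A :> \bar K)%E.
Proof. by rewrite /counting; case: ifP => // _; rewrite lee_fin. Qed.

Lemma sum_prob_res_cvg (K : realType) p (p_pr : prime p) :
  ((fun n => \sum_(k < n) p%:R^-1 ^+ k * (prob_res K p k - prob_res K p k.+1)) : K ^nat)
    @ \oo --> mean_res K p.
Proof.
have [C CP] := sum_prob_res K p_pr.
have C0 : (fun n => C * p%:R^-1 ^+ n) @ \oo --> (0 : K).
  apply: cvg_geometric; rewrite ger0_norm ?invr_ge0//.
  by rewrite invf_lt1 ?ltr1n ?ltr0n ?prime_gt0 ?prime_gt1.
apply: (@squeeze_cvgr _ _ _ _ (fun n => mean_res K p - C * p%:R^-1 ^+ n)
  (fun n => mean_res K p + C * p%:R^-1 ^+ n)).
- near=> n; have := CP n; rewrite ler_norml => /andP[lo hi].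
  by apply/andP; split; lra.
- by rewrite -[X in _ --> X]subr0; apply: cvgB => //; exact: cvg_cst.
- by rewrite -[X in _ --> X]addr0; apply: cvgD => //; exact: cvg_cst.
Unshelve. all: end_near. Qed.

(** The product is (1 + r^2)(1 - r^3) / (1 - r^5), to be expanded by p^5. *)
Lemma mean_lines (K : realType) p : prime p ->
  (\sum_(x < 6) p%:R^-1 ^+ #|chart_mask x|) * mean_res K p =
  (p%:R ^+ 3 - 1) * (p%:R ^+ 2 + 1) / (p%:R ^+ 5 - 1).
Proof.
move=> p_pr; rewrite sum_chart_mask /mean_res.
have p1 : 1 < p%:R :> K by rewrite ltr1n prime_gt1.
have p0 : p%:R != 0 :> K by rewrite pnatr_eq0 -lt0n prime_gt0.
have p5 : p%:R ^+ 5 - 1 != 0 :> K by rewrite subr_eq0 gt_eqF// exprn_egt1.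
move: p0 p5; move: (p%:R : K) => x x0 x5; field.
by rewrite x5 x0.
Qed.

Theorem theorem3 (R : realType) (p : nat) (p_pr : prime p)
    (haar : probability (padic_borel p_pr) R) (haarP : is_haar haar)
    (d : measure_display) (Omega : measurableType d) (P : probability Omega R)
    (xi : cubic_monomial -> {RV P >-> padic_borel p_pr})
    (xi_indep : mutually_independent xi)
    (xi_uniform : forall (m : cubic_monomial) (A : set (padic_borel p_pr)),
       measurable A -> distribution P (xi m) A = haar A) :
  (\int[P]_w
     counting (padic_lines_on (cubic_of (fun m => xi m w : padic_int p_pr)))
   = ((p%:R ^+ 3 - 1) * (p%:R ^+ 2 + 1) / (p%:R ^+ 5 - 1) : R)%:E)%E.
Proof.
(* A measurable set containing every degenerate cubic, since a degenerate zero remains singular at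
   each level. *)
pose N := \bigcap_n [set w | singular_mod (red_coef xi n w)].
have mS n : measurable [set w | singular_mod (red_coef xi n w)].
  exact: measurable_red_coef.
have mN : measurable N by exact: bigcapT_measurable.
have PN0 : P N = 0%E.
  have Nfin : P N \is a fin_num by exact: fin_num_measure.
  rewrite -(fineK Nfin); congr (_%:E); apply/eqP.
  rewrite eq_le fine_ge0 ?measure_ge0// andbT.
  (* The constant 36 is 48 times 3/4, which brings the exponent from n + 1 to n. *)
  apply: (@cvgr_to_ge _ \oo _ R (fun n => 36%:R * (3 / 4) ^+ n)).
    by apply: cvg_geometric; rewrite ger0_norm; lra.
  near=> n; rewrite -lee_fin fineK//.
  rewrite (_ : 36%:R * (3 / 4) ^+ n = 48%:R * (3 / 4) ^+ n.+1 :> R); last first.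
    by rewrite exprS; field.
  apply: le_trans (prob_singular_mod haarP xi_indep xi_uniform n).
  by apply: le_measure; [exact: mem_set|exact: mem_set|move=> w; apply].
have count_ge0 k w : (0 <= regular_count xi k w)%E.
  by apply: sume_ge0 => x _; exact: counting_ge0.
rewrite (@integral_null_modification _ _ _ P _
  (fun w => \sum_(k <oo) regular_count xi k w)%E N)//; last 4 first.
- by apply: ge0_emeasurable_sum => // k _; exact: measurable_regular_count.
- by move=> w; exact: counting_ge0.
- by move=> w; exact: nneseries_ge0.
- move=> w Nw /=; apply: counting_lines => cw; apply: Nw => n _.
  exact: degenerate_singular_mod.
rewrite integral_nneseries//; last by move=> k; exact: measurable_regular_count.
under eq_eseriesr do rewrite (integral_regular_count haarP xi_indep xi_uniform).
rewrite -mean_lines//; apply: cvg_lim => //.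
under eq_fun do rewrite sumEFin -mulr_sumr big_mkord.
apply: cvg_EFin; first by near=> n.
by apply: cvgMr; exact: sum_prob_res_cvg.
Unshelve. all: end_near. Qed.
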